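(* Let $q$ be a nonzero complex parameter that is not a root of unity, and let the nonzero scalars $y_i=y_i(q)$, $z_i=z_i(q)$ below be allowed to depend on $q$ and have finite nonzero limits $y_i^0,z_i^0$ as $q\to1$. Put $i'=N+1-i$. The following matrices $A\in\mathrm{End}(\mathbb C^N)$ quantize (in the sense defined in the context) the indicated classical points $A_0=\lim_{q\to1}A$. (1) $\mathfrak g=\mathfrak{sl}(N)$ or $\mathfrak{so}(N)$, $m\in\mathbb N$, $m\le N/2$, either overall sign: $$A=\pm\Bigl(\sum_{i=1}^m q^{-m}(1-q^{-N+2m})e_{ii}+\sum_{m<i<m'}q^{-m}e_{ii}+\sum_{i\le m\text{ or }i'\le m}y_ie_{ii'}\Bigr),\qquad y_iy_{i'}=q^{-N},$$ with $A_0=\pm\bigl(\sum_{m<i<m'}e_{ii}+\sum_{i\le m\text{ or }i'\le m}y_i^0e_{ii'}\bigr)$, $y^0_iy^0_{i'}=1$. (2) $\mathfrak g=\mathfrak{sp}(N)$, $m\in 2\mathbb N$, $m\le N/2$, either overall sign: $$A=\pm\Bigl(\sum_{i=1}^m q^{-m}(1-q^{-N+2m})e_{ii}+\sum_{m<i<m'}q^{-m}e_{ii}+\sum_{\substack{i\le m\text{ or }i'\le m\\ i\ \mathrm{odd}}}z_i(e_{i,i'-1}-e_{i+1,i'})\Bigr),$$ where $z_iz_{i'-1}=q^{-N}$ for all odd $i$ occurring in the sum, with $A_0=\pm\bigl(\sum_{m<i<m'}e_{ii}+\sum_{i\le m\text{ or }i'\le m,\ i\text{ odd}}z_i^0(e_{i,i'-1}-e_{i+1,i'})\bigr)$,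 $z_i^0z_{i'-1}^0=1$. (3) $\mathfrak g=\mathfrak{sp}(N)$: $$A=\sum_{i=1}^Ny_ie_{ii'},\qquad y_iy_{i'}=-q^{-N-2},$$ with $A_0=\sum_{i=1}^Ny_i^0e_{ii'}$, $y^0_iy^0_{i'}=-1$. (4) $\mathfrak g=\mathfrak{so}(N)$, $N$ even: $$A=\sum_{\substack{1\le i\le N-1\\ i\ \mathrm{odd}}}z_i(e_{i,i'-1}-e_{i+1,i'}),\qquad z_iz_{i'-1}=-q^{-N+2}\ \text{ for odd } i\le N/2,$$ with $A_0=\sum_{1\le i\le N-1,\ i\text{ odd}}z_i^0(e_{i,i'-1}-e_{i+1,i'})$, $z_i^0z_{i'-1}^0=-1$.
   Context: $\mathfrak g$ is a simple complex Lie algebra $\mathfrak{sl}(N)$, $\mathfrak{so}(N)$ or $\mathfrak{sp}(N)$ (with $N$ even for $\mathfrak{sp}(N)$), and $e_{ij}$ are the standard matrix units in $\mathrm{End}(\mathbb C^N)$. R-matrix. For $\mathfrak g=\mathfrak{sl}(N)$, $$R=q\sum_{i}e_{ii}\otimes e_{ii}+\sum_{i\ne j}e_{ii}\otimes e_{jj}+(q-q^{-1})\sum_{i<j}e_{ji}\otimes e_{ij}.$$ For $\mathfrak g=\mathfrak{so}(N),\mathfrak{sp}(N)$, $$R=\sum_{i,j=1}^N q^{\delta_{ij}-\delta_{ij'}}e_{ii}\otimes e_{jj}+(q-q^{-1})\sum_{j<i}\bigl(e_{ij}\otimes e_{ji}-\kappa_i\kappa_jq^{\rho_i-\rho_j}e_{ij}\otimes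 e_{i'j'}\bigr).$$ Here $\rho_{i'}=-\rho_i$, and $\rho_i=\frac N2-i$ for $i\le N/2$ if $\mathfrak g=\mathfrak{so}(N)$ (with $\rho_i=0$ for $i=i'$), while $\rho_i=\frac N2+1-i$ for $i\le N/2$ if $\mathfrak g=\mathfrak{sp}(N)$ ($\rho$ is the half-sum of positive roots). All $\kappa_i=1$ for $\mathfrak{so}(N)$; for $\mathfrak{sp}(N)$, $\kappa_i=1$ if $i\le N/2$ and $\kappa_i=-1$ otherwise. Let $P$ be the flip on $\mathbb C^N\otimes\mathbb C^N$, $S=PR$, $R_{12}=R$, $R_{21}=PRP$, $A_1=A\otimes1$, $A_2=1\otimes A$. Put $\epsilon=+1$ for $\mathfrak{so}(N)$ and $\epsilon=-1$ for $\mathfrak{sp}(N)$. For $\mathfrak{so}(N),\mathfrak{sp}(N)$, $\varpi$ is the $U_q(\mathfrak g)$-invariant projector of $\mathbb C^N\otimes\mathbb C^N$ onto its one-dimensional trivial submodule (equivalently, the spectral projector of $S$ for the eigenvalue $\epsilon q^{-N+\epsilon}$). Definition. A matrix $A$ with $\lim_{q\to1}A=A_0$ is a quantization of $A_0$ (it ''quantizes'' $A_0$) if it satisfies the reflection equation $$R_{21}A_1R_{12}A_2=A_2R_{21}A_1R_{12}$$ and, for $\mathfrak g=\mathfrak{so}(N)$ or $\mathfrak{sp}(N)$, also $$A_2S_{12}A_2\varpi=\epsilon q^{-N+\epsilon}\varpi=\varpi A_2S_{12}A_2 .$$ *)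

(* Defs.v *)
From HB Require Import structures.
From mathcomp Require Import all_boot all_order all_algebra.
From mathcomp Require Import mxtens.
From mathcomp Require Import all_classical all_reals topology normedtype.
Set Implicit Arguments.
Unset Strict Implicit.
Unset Printing Implicit Defensive.
Import Order.TTheory GRing.Theory Num.Theory numFieldNormedType.Exports.
Local Open Scope classical_set_scope.
Local Open Scope ring_scope.

Inductive lie_type := SL | SO | SP.

(* The simple algebras sl(N), so(N), sp(N); the bound for so(N) also lets in
   so(4), which is only semisimple. *)
Definition admissible (g : lie_type) (N : nat) : bool :=
  match g with
  | SL => (1 < N)%N
  | SO => (2 < N)%N
  | SP => (0 < N)%N && ~~ odd N
  end.

(* Indices are natural numbers running from 1 to N; [dual N i] is i' = N + 1 - i. *)
Definition dual (N i : nat) : nat := (N.+1 - i)%N.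

Definition outer (N m i : nat) : bool :=
  (1 <= i <= N)%N && ((i <= m) || (dual N i <= m))%N.

Definition eps (g : lie_type) : int := if g is SP then -1 else 1.

Definition kappa (g : lie_type) (N i : nat) : int :=
  if g is SP then (if (2 * i <= N)%N then 1 else -1) else 1.

(* Twice rho_i: for so(N) with N odd, rho_i is a proper half-integer except at
   the middle index i = i', where it is 0. *)
Definition rho2_upper (g : lie_type) (N i : nat) : int :=
  if g is SP then N.+2%:Z - (2 * i)%:Z else N%:Z - (2 * i)%:Z.

Definition rho2 (g : lie_type) (N i : nat) : int :=
  if i == dual N i then 0
  else if (2 * i <= N)%N then rho2_upper g N i
  else - rho2_upper g N (dual N i).

Section Quantization.
Variable K : numFieldType.

Definition munit (N i j : nat) : 'M[K]_N :=
  \matrix_(a < N, b < N) ((a.+1 == i) && (b.+1 == j))%:R.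

Definition flip (N : nat) : 'M[K]_(N * N) :=
  \sum_(1 <= i < N.+1) \sum_(1 <= j < N.+1) munit N i j *t munit N j i.

(* [s] is a square root of q, so that q^(rho_i - rho_j) is
   s ^ (2 rho_i - 2 rho_j). *)
Definition Rmat (g : lie_type) (N : nat) (q s : K) : 'M[K]_(N * N) :=
  let e := munit N in
  match g with
  | SL =>
      q *: (\sum_(1 <= i < N.+1) e i i *t e i i)
      + \sum_(1 <= i < N.+1) \sum_(1 <= j < N.+1 | i != j) e i i *t e j j
      + (q - q^-1) *:
        \sum_(1 <= i < N.+1) \sum_(1 <= j < N.+1 | (i < j)%N) e j i *t e i j
  | _ =>
      \sum_(1 <= i < N.+1) \sum_(1 <= j < N.+1)
        q ^ ((i == j)%:Z - (i == dual N j)%:Z) *: (e i i *t e j j)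
      + (q - q^-1) *:
        \sum_(1 <= i < N.+1) \sum_(1 <= j < N.+1 | (j < i)%N)
          (e i j *t e j i
           - ((kappa g N i * kappa g N j)%:~R * s ^ (rho2 g N i - rho2 g N j))
             *: (e i j *t e (dual N i) (dual N j)))
  end.

Definition Smat (g : lie_type) (N : nat) (q s : K) : 'M[K]_(N * N) :=
  flip N *m Rmat g N q s.

Definition R21 (g : lie_type) (N : nat) (q s : K) : 'M[K]_(N * N) :=
  flip N *m Rmat g N q s *m flip N.

Definition fst_leg (N : nat) (A : 'M[K]_N) : 'M[K]_(N * N) := A *t 1%:M.
Definition snd_leg (N : nat) (A : 'M[K]_N) : 'M[K]_(N * N) := 1%:M *t A.

(* The projection onto the [l]-eigenspace of [S] along the image of [S - l].
   The library's [proj_mx] acts on row vectors; for a semisimple eigenvalue the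
   same matrix, acting on column vectors, is the spectral projector of [S]
   on columns. *)
Definition spectral_projector (n : nat) (S : 'M[K]_n) (l : K) : 'M[K]_n :=
  proj_mx (eigenspace S l) (S - l%:M).

Definition triv_eigenvalue (g : lie_type) (N : nat) (q : K) : K :=
  (eps g)%:~R * q ^ (- N%:Z + eps g).

Definition varpi (g : lie_type) (N : nat) (q s : K) : 'M[K]_(N * N) :=
  spectral_projector (Smat g N q s) (triv_eigenvalue g N q).

Definition reflection_equation (g : lie_type) (N : nat) (q s : K)
    (A : 'M[K]_N) : Prop :=
  R21 g N q s *m fst_leg A *m Rmat g N q s *m snd_leg A
  = snd_leg A *m R21 g N q s *m fst_leg A *m Rmat g N q s.

Definition invariant_form_equation (g : lie_type) (N : nat) (q s : K)
    (A : 'M[K]_N) : Prop :=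
  let A2 := snd_leg A in
  let S := Smat g N q s in
  let w := varpi g N q s in
  A2 *m S *m A2 *m w = triv_eigenvalue g N q *: w /\
  triv_eigenvalue g N q *: w = w *m A2 *m S *m A2.

Definition generic (q : K) : Prop :=
  q != 0 /\ forall n : nat, (0 < n)%N -> ~~ n.-unity_root q.

(* q tends to 1 through admissible values of the parameter. *)
Definition at_one : set_system K := within [set q | generic q] (nbhs (1 : K)).

Definition square_root_choice (r : K -> K) : Prop :=
  forall q, generic q -> r q ^+ 2 = q.

Definition quantizes (g : lie_type) (N : nat) (r : K -> K)
    (A : K -> 'M[K]_N) (A0 : 'M[K]_N) : Prop :=
  A q @[q --> at_one] --> A0 /\
  forall q, generic q ->
    reflection_equation g q (r q) (A q) /\
    (g <> SL -> invariant_form_equation g q (r q) (A q)).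

(* Nonzero scalars y_i(q), for i in [I], with nonzero limits at q = 1. *)
Definition scalar_family (I : pred nat) (y : nat -> K -> K) (y0 : nat -> K)
    : Prop :=
  forall i, I i ->
    [/\ forall q, generic q -> y i q != 0, y0 i != 0
      & y i q @[q --> at_one] --> y0 i].

Definition diag_part (N m : nat) (q : K) : 'M[K]_N :=
  \sum_(1 <= i < m.+1)
     (q ^ (- m%:Z) * (1 - q ^ (- N%:Z + (2 * m)%:Z))) *: munit N i i
  + \sum_(1 <= i < N.+1 | (m < i < dual N m)%N) q ^ (- m%:Z) *: munit N i i.

Definition diag_part0 (N m : nat) : 'M[K]_N :=
  \sum_(1 <= i < N.+1 | (m < i < dual N m)%N) munit N i i.

Definition anti_part (N : nat) (I : pred nat) (y : nat -> K) : 'M[K]_N :=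
  \sum_(1 <= i < N.+1 | I i) y i *: munit N i (dual N i).

Definition skew_part (N : nat) (I : pred nat) (z : nat -> K) : 'M[K]_N :=
  \sum_(1 <= i < N.+1 | I i)
     z i *: (munit N i (dual N i).-1 - munit N i.+1 (dual N i)).

End Quantization.

(* Main.v *)
Require Import Defs.
From HB Require Import structures.
From mathcomp Require Import all_boot all_order all_algebra.
From mathcomp Require Import complex mxtens.
From mathcomp Require Import all_classical all_reals topology normedtype.
From mathcomp Require Import zify ring.
Set Implicit Arguments.
Unset Strict Implicit.
Unset Printing Implicit Defensive.
Import Order.TTheory GRing.Theory Num.Theory numFieldNormedType.Exports.
Local Open Scope classical_set_scope.
Local Open Scope ring_scope.

(* Multiplying by the flip P turns the reflection equation into
   S A S A = A S A S, with A acting on the second tensor leg. In each case A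
   satisfies A^2 = c A + p and preserves the span of the indices k < i < k' for
   every k (every even k for the skew matrices), and the R-matrix restricted to
   these indices is again of the same shape. So one can start from the middle of
   A, which is scalar, empty or diag(z, -z), and add the outer indices one or two
   pairs at a time. A vector of the tensor square having a leg on an outer index
   yields a finite identity in the entries of A. On the inner tensor square the
   only new term is a multiple of the invariant vector cup, so the induction
   needs, besides the reflection equation, S A cup = mu (A - c) cup with
   mu = q or -1/q, the dual relation for the invariant functional cap, and the
   value of cap(A cup).

   Since mu p is the trivial eigenvalue, the same relations give
   A S A cup = (mu p) cup, hence the second equation: by the skein relation
   S - S^-1 = (q - q^-1)(1 - cup cap), the spectral projector is a multiple of
   cup cap. *)

(** The R-matrix cut to k < i < k' is that of the same series in rank N - 2k with unchanged weights,
    as rho_i depends only on N/2 - i; its trivial eigenvalue is q^(2k) times the full one. The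
    obstacle is that the cut of A is not a quantum point of the smaller algebra: p keeps its value,
    whereas the normalization would require mu p to be the smaller eigenvalue. Hence the induction
    carries S A cup = mu (A - c) cup, which does not mention p, and mu p is compared with the
    eigenvalue only at k = 0.

    The value of mu records where the off-diagonal part of A sends the outer terms of cup. For
    antidiagonal A these are the e_i (x) e_i, on which S is q; for skew A they are q-antisymmetric
    combinations of e_i (x) e_(i+1) and e_(i+1) (x) e_i, on which S is -1/q. The constant c is then
    forced by the middle of A: if that is a scalar r and S cup = l cup there, then l r = mu (r -
    c). *)

Definition inside (N k i : nat) : bool := (k < i < dual N k)%N.

(* Hypotheses about ring elements are cleared: they only slow [lia] down. *)
Ltac nlia :=
  repeat match goal with
  | H : forall _, _ |- _ => clear H
  | H : is_true (negb (@eq_op ?T _ _)) |- _ =>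
      lazymatch T with
      | Datatypes_nat__canonical__eqtype_Equality => fail
      | _ => clear H end
  | H : @eq ?T _ _ |- _ =>
      lazymatch T with
      | nat => fail | bool => fail
      | Equality.sort Datatypes_nat__canonical__eqtype_Equality => fail
      | _ => clear H end
  end;
  unfold inside, dual in *; lia.

Ltac decide_nat :=
  repeat match goal with
  | |- context[@eq_op Datatypes_nat__canonical__eqtype_Equality ?a ?b] =>
      first [ rewrite (_ : (a == b) = true); last by nlia
            | rewrite (_ : (a == b) = false); last by nlia ]
  | |- context[(?a < ?b)%N] =>
      first [ rewrite (_ : (a < b)%N = true); last by nlia
            | rewrite (_ : (a < b)%N = false); last by nlia ]
  end.

(** Proves an identity modulo two relations: the cofactors [z] and [z'] are given by hand and [ring]
    checks the rest. *)
Lemma lincomb2 (R : comPzRingType) (x y z z' l l' r r' : R) : l = r -> l' = r' ->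
  x - y = z * (l - r) + z' * (l' - r') -> x = y.
Proof. by move=> -> -> e; apply: subr0_eq; rewrite e !subrr !mulr0 addr0. Qed.

(** The form in which [field] asks for q - 1/q to be nonzero. *)
Lemma sqrB1_neq0 (F : fieldType) (q : F) :
  q != 0 -> q - q^-1 != 0 -> q * q - 1 != 0.
Proof.
move=> q0; apply: contra_neq => /eqP; rewrite subr_eq0 => /eqP e.
by apply: (mulfI q0); rewrite mulrBr e mulfV // subrr mulr0.
Qed.

(* An element of the tensor square is a function of a pair of indices, its
   coordinates. Everything is restricted to the indices k < i < k', and k is the
   induction variable. Weights u i = kappa_i q^(rho_i) and v i = (u i)^-1 give
   the orthosymplectic cases; sl(N) is u = v = 0. *)
Section Tensors.
Variables (K : fieldType) (N : nat) (q : K) (u v : nat -> K).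
Variable (h : nat -> nat -> K).

Local Notation d := (q - q^-1).
Local Notation D := (dual N).
Implicit Types f g : nat -> nat -> K.

(** A partial sum of [cap]: the term e_ij (x) e_i'j' of R occurs only for j < i, so the invariant
    functional is cut off below the index b. *)
Definition pairing k b f : K := \sum_(k.+1 <= c < b) v c * f c (D c).

(* S = P R. *)
Definition braid k f a b : K :=
  h a b * f b a + (a < b)%N%:R * d * f a b
  - (b == D a)%:R * d * u b * pairing k b f.

Definition cap k f : K := pairing k (D k) f.

Definition cup a b : K := (b == D a)%:R * u b.

Lemma pairing_ext k b f g : (b <= D k)%N ->
  (forall i, inside N k i -> f i (D i) = g i (D i)) -> pairing k b f = pairing k b g.
Proof.
move=> hb e; apply: eq_big_nat => i hi; rewrite e //; nlia.
Qed.

Lemma pairing_sub k b f x g :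
  pairing k b (fun i j => f i j - x * g i j) = pairing k b f - x * pairing k b g.
Proof.
by rewrite /pairing mulr_sumr -sumrB; apply: eq_bigr => i _; ring.
Qed.

Lemma braid_ext k f g a b : inside N k a -> inside N k b ->
  (forall i j, inside N k i -> inside N k j -> f i j = g i j) ->
  braid k f a b = braid k g a b.
Proof.
move=> ha hb e; rewrite /braid !e // (@pairing_ext k b f g) //; first by nlia.
by move=> i hi; apply: e => //; nlia.
Qed.

Lemma braid_sub k f x g a b :
  braid k (fun i j => f i j - x * g i j) a b
  = braid k f a b - x * braid k g a b.
Proof. by rewrite /braid pairing_sub; ring. Qed.

Lemma cap_ext k f g :
  (forall i j, inside N k i -> inside N k j -> f i j = g i j) ->
  cap k f = cap k g.
Proof. by move=> e; apply: pairing_ext => // i hi; apply: e => //; nlia. Qed.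

Lemma cap_sub k f x g :
  cap k (fun i j => f i j - x * g i j) = cap k f - x * cap k g.
Proof. exact: pairing_sub. Qed.

Lemma cap_lin k x f y g :
  cap k (fun i j => x * f i j + y * g i j) = x * cap k f + y * cap k g.
Proof.
by rewrite /cap /pairing !mulr_sumr -big_split; apply: eq_bigr => i _ /=; ring.
Qed.

Lemma pairing_peel k b f : (k.+1 < b)%N ->
  pairing k b f = v k.+1 * f k.+1 (D k.+1) + pairing k.+1 b f.
Proof. by move=> hb; rewrite /pairing big_ltn. Qed.

Lemma cap_peel k f : (k.+1 < N - k)%N ->
  cap k f = v k.+1 * f k.+1 (D k.+1) + cap k.+1 f + v (D k.+1) * f (D k.+1) k.+1.
Proof.
move=> hk; rewrite /cap pairing_peel; last by nlia.
rewrite -addrA; congr (_ + _); rewrite /pairing.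
have -> : D k = (D k.+1).+1 by nlia.
rewrite big_nat_recr /=; last by nlia.
by have -> : D (D k.+1) = k.+1 by nlia.
Qed.

(* The action of S on the part of the tensor square spanned by the indices
   k < i < k', once the two extreme indices are split off. *)
Section Peel.
Variables (k : nat) (w : K).
Hypothesis hk : (k.+1 < N - k)%N.
(** The centre i = i' of so(N), N odd, is excluded because its coefficient is 1. The antidiagonal
    coefficient [w] is 1/q in the orthosymplectic cases and 1 for sl(N). *)
Hypothesis h_offdiag : forall a b, inside N k a -> inside N k b ->
  ~~ ((a == b) && (a == D a)) ->
  h a b = if a == b then q else if a == D b then w else 1.
Local Notation o := k.+1.
Local Notation o' := (D k.+1).
Local Notation mid := (inside N k.+1).

Ltac peel_tac := rewrite /braid h_offdiag /pairing; try nlia; decide_nat;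
  rewrite ?(big_geq (leqnn _)) /=; try ring.

Lemma braid_oo f : braid k f o o = q * f o o.
Proof. peel_tac. Qed.

Lemma braid_ob f b : mid b -> braid k f o b = f b o + d * f o b.
Proof. move=> hb; peel_tac. Qed.

Lemma braid_bo f b : mid b -> braid k f b o = f o b.
Proof. move=> hb; peel_tac. Qed.

Lemma braid_oo' f : braid k f o o' =
  w * f o' o + d * f o o' - d * u o' * (v o * f o o' + cap o f).
Proof.
rewrite /braid pairing_peel ?h_offdiag; try nlia.
by rewrite /cap; decide_nat; rewrite /=; ring.
Qed.

Lemma braid_o'o f : braid k f o' o = w * f o o'.
Proof. peel_tac. Qed.

Lemma braid_bo' f b : mid b -> braid k f b o' = f o' b + d * f b o'.
Proof. move=> hb; peel_tac. Qed.

Lemma braid_o'b f b : mid b -> braid k f o' b = f b o'.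
Proof. move=> hb; peel_tac. Qed.

Lemma braid_o'o' f : braid k f o' o' = q * f o' o'.
Proof. peel_tac. Qed.

Lemma braid_mid f a b : mid a -> mid b ->
  braid k f a b = braid k.+1 f a b - d * v o * f o o' * cup a b.
Proof.
move=> ha hb; rewrite /braid pairing_peel; last by nlia.
by rewrite /cup; ring.
Qed.

End Peel.

Lemma inside_peel k a : inside N k a ->
  [\/ a = k.+1, a = D k.+1 | inside N k.+1 a].
Proof.
move=> ha; case: (eqVneq a k.+1) => [->|?]; first by constructor 1.
case: (eqVneq a (D k.+1)) => [->|?]; first by constructor 2.
by constructor 3; nlia.
Qed.

(* [cup] spans the trivial submodule and [cap] is its invariant functional;
   the first field is the skein relation S - S^-1 = (q - q^-1)(1 - cup cap). *)
Record braid_inv (k : nat) (l : K) : Prop := BraidInv {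
  braidK : forall f a b, inside N k a -> inside N k b ->
    braid k (braid k f) a b
    = f a b + d * braid k f a b - d * l * cup a b * cap k f;
  cap_braid : forall f, cap k (braid k f) = l * cap k f;
  braid_cup : forall a b, inside N k a -> inside N k b ->
    braid k cup a b = l * cup a b;
  cap_cup : d * l * cap k cup = 1 + d * l - l ^+ 2 }.

Ltac cup_simpl := rewrite /cup; decide_nat; rewrite ?mul1r ?mul0r.

(** The relation [cap_cup] is the skein relation evaluated on cup. It expresses the inner cap (cup)
    as a rational function of q and l, so that all coordinates with an outer leg become rational
    identities in q, l and the weight of k + 1. *)
Lemma braid_inv_peel k (l : K) : (k.+1 < N - k)%N -> q != 0 -> d != 0 -> l != 0 ->
  (forall a b, inside N k a -> inside N k b -> ~~ ((a == b) && (a == D a)) ->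
     h a b = if a == b then q else if a == D b then q^-1 else 1) ->
  u k.+1 != 0 -> v k.+1 = (u k.+1)^-1 ->
  u (D k.+1) = q * l * u k.+1 -> v (D k.+1) = (u (D k.+1))^-1 ->
  braid_inv k.+1 (q ^+ 2 * l) -> braid_inv k l.
Proof.
move=> hk q0 d0 l0 hh u0 hv hu' hv' [hK hcap hcup hcc].
have [[s1 s2] s3] := (braid_oo hk hh, braid_ob hk hh, braid_bo hk hh).
have [[s4 s5] s6] := (braid_oo' hk hh, braid_o'o hk hh, braid_bo' hk hh).
have [[s7 s8] s9] := (braid_o'b hk hh, braid_o'o' hk hh, braid_mid hk).
have midext f (x : K) g a b : inside N k.+1 a -> inside N k.+1 b ->
  (forall i j, inside N k.+1 i -> inside N k.+1 j -> f i j = g i j - x * cup i j) ->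
  braid k.+1 f a b = braid k.+1 g a b - x * (q ^+ 2 * l * cup a b).
  move=> ha hb e; rewrite -hcup // -braid_sub; exact: braid_ext.
have capmid f : cap k.+1 (braid k f)
  = q ^+ 2 * l * cap k.+1 f - d * v k.+1 * f k.+1 (D k.+1) * cap k.+1 cup.
  by rewrite -hcap -cap_sub; apply: cap_ext => i j hi hj; rewrite s9.
have x1 : v (D k.+1) = (q * l * u k.+1)^-1 by rewrite hv' hu'.
have hcc' : cap k cup = cap k.+1 cup + q * l + (q * l)^-1.
  rewrite cap_peel //; cup_simpl; rewrite x1 hv hu'.
  by field; rewrite q0 l0 u0.
have hX : cap k.+1 cup
    = (1 + d * (q ^+ 2 * l) - (q ^+ 2 * l) ^+ 2) / (d * (q ^+ 2 * l)).
  by rewrite -hcc mulrAC mulfV ?mul1r // !mulf_neq0 ?expf_neq0.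
have [m1 m2 m3 m4] := And4 u0 q0 l0 (sqrB1_neq0 q0 d0).
split.
- move=> f a b /inside_peel ha /inside_peel hb.
  have ec := cap_peel f hk.
  case: ha hb => [->|->|ha] [->|->|hb].
  1-8: cup_simpl;
    rewrite !(s1,s8,s4,s5,s2,s3,s6,s7) // ?capmid ?ec ?hu' ?x1 ?hv ?hX;
    by field; rewrite ?m1 ?m2 ?m3 ?m4.
  rewrite s9 // (midext _ (d * v k.+1 * f k.+1 (D k.+1)) (braid k.+1 f)) //;
    last by move=> i j hi hj; rewrite s9.
  by rewrite hK // s4 s9 // ec x1 hv hu'; field; rewrite m1 m2 m3.
- move=> f; rewrite !(cap_peel _ hk) s4 s5 capmid x1 hv hu' hX.
  by field; rewrite m1 m2 m3 m4.
- move=> a b /inside_peel ha /inside_peel hb.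
  case: ha hb => [->|->|ha] [->|->|hb].
  1-8: rewrite (s1,s8,s4,s5,s2,s3,s6,s7) // ?hX; cup_simpl;
    by rewrite ?hu' ?x1 ?hv; field; rewrite ?m1 ?m2 ?m3 ?m4.
  rewrite s9 // hcup //; cup_simpl.
  by rewrite hu' hv; field; rewrite m1 m2.
- by rewrite hcc' hX; field; rewrite m2 m3 m4.
Qed.

Lemma cap_empty k f : (D k <= k.+1)%N -> cap k f = 0.
Proof. by move=> hk; rewrite /cap /pairing big_geq. Qed.

(** With no indices left, only [cap_cup] has content: it says that l is q or -1/q, the values of eps
    q^eps for so and sp. *)
Lemma braid_inv_empty k l : (D k <= k.+1)%N -> 1 + d * l - l ^+ 2 = 0 ->
  braid_inv k l.
Proof.
move=> hk hl; split.
- by move=> f a b ha hb; nlia.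
- by move=> f; rewrite !cap_empty // mulr0.
- by move=> a b ha hb; nlia.
- by rewrite cap_empty // mulr0 hl.
Qed.

(** The centre of so(N), N odd, where S is the identity of a one-dimensional space. *)
Lemma braid_inv_single k : D k = k.+2 -> h k.+1 k.+1 = 1 -> u k.+1 = 1 ->
  v k.+1 = 1 -> braid_inv k 1.
Proof.
move=> hk h1 u1 v1.
have mid a : inside N k a -> a = k.+1 by nlia.
have dk : D k.+1 = k.+1 by nlia.
have capE f : cap k f = f k.+1 k.+1.
  by rewrite /cap /pairing hk big_nat1 v1 dk mul1r.
have bE f : braid k f k.+1 k.+1 = f k.+1 k.+1.
  by rewrite /braid /pairing (big_geq (leqnn _)) ltnn h1 /=; ring.
have cE : cup k.+1 k.+1 = 1 by rewrite /cup dk eqxx u1 mul1r.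
split.
- by move=> f a b /mid-> /mid->; rewrite !bE cE capE; ring.
- by move=> f; rewrite !capE bE mul1r.
- by move=> a b /mid-> /mid->; rewrite bE mul1r.
- by rewrite capE cE; ring.
Qed.

Section BraidDescent.
Variable lam : nat -> K.
Hypotheses (q0 : q != 0) (d0 : d != 0) (lam0 : forall k, lam k != 0)
  (lamS : forall k, lam k.+1 = q ^+ 2 * lam k).

(** In terms of rho, u_i' / u_i = eps q^(-2 rho_i). For i = k + 1 this is q times the trivial
    eigenvalue of S cut to k < i < k'. *)
Definition dual_weights := forall k, (k.+1 < N - k)%N ->
  [/\ u k.+1 != 0, v k.+1 = (u k.+1)^-1, u (D k.+1) = q * lam k * u k.+1
    & v (D k.+1) = (u (D k.+1))^-1].

Hypothesis hw : dual_weights.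
Hypothesis hh : forall a b, inside N 0 a -> inside N 0 b ->
  ~~ ((a == b) && (a == D a)) ->
  h a b = if a == b then q else if a == D b then q^-1 else 1.

Let hhk k a b : inside N k a -> inside N k b -> ~~ ((a == b) && (a == D a)) ->
  h a b = if a == b then q else if a == D b then q^-1 else 1.
Proof. by move=> ha hb; apply: hh; nlia. Qed.

Lemma braid_inv_all :
  (forall k, (2 * k <= N)%N -> (N <= (2 * k).+1)%N -> braid_inv k (lam k)) ->
  forall k, (2 * k <= N)%N -> braid_inv k (lam k).
Proof.
move=> base k; have [n] := ubnP (N - 2 * k); elim: n k => // n IH k hn hk.
have [hN|hN] := leqP N (2 * k).+1; first exact: base.
have hk' : (k.+1 < N - k)%N by lia.
have [x1 x2 x3 x4] := hw hk'.
apply: (braid_inv_peel hk' q0 d0 (lam0 k) (@hhk k) x1 x2 x3 x4).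
by rewrite -lamS; apply: IH; lia.
Qed.

End BraidDescent.

(** * The rows of A and the relations carried by the induction *)

Variables (al be : nat -> K) (sg : nat -> nat).

(* Row b of A is al b in column b plus be b in column sg b. *)
Definition act2 f a b : K := al b * f a b + be b * f a (sg b).

Lemma act2_sub f x g a b :
  act2 (fun i j => f i j - x * g i j) a b = act2 f a b - x * act2 g a b.
Proof. by rewrite /act2; ring. Qed.

(** Entrywise conditions sufficient for A^2 = c A + p. They also cover [sg b = b], where the
    diagonal entry of A is [al b + be b]. *)
Definition act_quadratic (k : nat) (c p : K) := forall b, inside N k b ->
  [/\ inside N k (sg b), sg (sg b) = b, al b ^+ 2 + be b * be (sg b) = c * al b + p
    & be b * al (sg b) = be b * (c - al b)].

Lemma act2K k c p f a b : act_quadratic k c p -> inside N k b ->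
  act2 (act2 f) a b = c * act2 f a b + p * f a b.
Proof.
move=> hA /hA [hb ss e1 e2]; rewrite /act2 ss.
transitivity ((al b ^+ 2 + be b * be (sg b)) * f a b
  + (al b * be b + be b * al (sg b)) * f a (sg b)); first by ring.
by rewrite e1 e2; ring.
Qed.

Lemma act2_ext k f g a b : inside N k b -> inside N k (sg b) ->
  (forall j, inside N k j -> f a j = g a j) ->
  act2 f a b = act2 g a b.
Proof. by move=> hb hsb e; rewrite /act2 !e. Qed.

(* For A^2 = c A + p the first field says A_2 S A_2 cup = mu p cup, and dually for
   [cap]; here mu is q or -1/q, the eigenvalue of S on the part of A_2 cup that
   lies in the square of the outer indices. *)
Record cup_inv (k : nat) (l mu c : K) : Prop := CupInv {
  braid_act_cup : forall a b, inside N k a -> inside N k b ->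
    braid k (act2 cup) a b = mu * (act2 cup a b - c * cup a b);
  cap_act_braid : forall f,
    cap k (act2 (braid k f)) = mu * (cap k (act2 f) - c * cap k f);
  cap_act_cup : d * l * cap k (act2 cup) = c * (1 + mu * l) }.

(* The reflection equation multiplied by P on the left. *)
Definition reflection k := forall f a b, inside N k a -> inside N k b ->
  braid k (act2 (braid k (act2 f))) a b = act2 (braid k (act2 (braid k f))) a b.

(** * Adding one pair of outer indices to an antidiagonal A *)

Section PeelOne.
Variables (k : nat) (w c p : K).
Hypothesis hk : (k.+1 < N - k)%N.
Local Notation o := k.+1.
Local Notation o' := (D k.+1).
Local Notation mid := (inside N k.+1).
Hypothesis hh : forall a b, inside N k a -> inside N k b ->
  ~~ ((a == b) && (a == D a)) ->
  h a b = if a == b then q else if a == D b then w else 1.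
Hypothesis hA : act_quadratic k.+1 c p.
(** The outer block [[c, b], [b', 0]] with b b' = p has characteristic polynomial x^2 - c x - p. *)
Hypotheses (alo : al o = c) (alo' : al o' = 0) (bep : be o * be o' = p).
Hypotheses (sgo : sg o = o') (sgo' : sg o' = o).

Let s1 := braid_oo hk hh.
Let s2 := braid_ob hk hh.
Let s3 := braid_bo hk hh.
Let s4 := braid_oo' hk hh.
Let s5 := braid_o'o hk hh.
Let s6 := braid_bo' hk hh.
Let s7 := braid_o'b hk hh.
Let s8 := braid_o'o' hk hh.
Let s9 := braid_mid hk.

Let Ao f a : act2 f a o = c * f a o + be o * f a o'.
Proof. by rewrite /act2 alo sgo. Qed.
Let Ao' f a : act2 f a o' = be o' * f a o.
Proof. by rewrite /act2 alo' sgo' mul0r add0r. Qed.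
Let midsg b : mid b -> mid (sg b).
Proof. by case/hA. Qed.

Let act_mid f a b : mid a -> mid b ->
  act2 (braid k f) a b
  = act2 (braid k.+1 f) a b - d * v o * f o o' * act2 cup a b.
Proof.
by move=> ha hb; rewrite /act2 !s9 ?midsg //; ring.
Qed.

Let cap_act_mid f : cap o (act2 (braid k f))
  = cap o (act2 (braid o f)) - d * v o * f o o' * cap o (act2 cup).
Proof. by rewrite -cap_sub; apply: cap_ext => i j hi hj; rewrite act_mid. Qed.

(** Apart from its diagonal contribution, A cup has outer components only on o (x) o and o' (x) o',
    where S is q. The inner indices enter the coordinate (o, o') through cap (A cup), which is why
    [cup_inv] records its value. *)
Lemma cup_inv_peel l : q != 0 -> d != 0 -> l != 0 -> w = q^-1 ->
  u o != 0 -> v o = (u o)^-1 -> u o' = q * l * u o -> v o' = (u o')^-1 ->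
  cup_inv k.+1 (q ^+ 2 * l) q c -> cup_inv k l q c.
Proof.
move=> q0 d0 l0 hw u0 hv hu' hv' [h1 h2 h3].
have x1 : v o' = (q * l * u o)^-1 by rewrite hv' hu'.
have ht : cap o (act2 cup) = c * (1 + q * (q ^+ 2 * l)) / (d * (q ^+ 2 * l)).
  by rewrite -h3 mulrAC mulfV ?mul1r // !mulf_neq0 ?expf_neq0.
have [m1 m2 m3 m4] := And4 u0 q0 l0 (sqrB1_neq0 q0 d0).
split.
- move=> a b /inside_peel ha /inside_peel hb.
  case: ha hb => [->|->|ha] [->|->|hb].
  1-8: try have hsa := midsg ha; try have hsb := midsg hb;
    rewrite (s1,s8,s4,s5,s2,s3,s6,s7) // ?ht ?(Ao,Ao') ?/act2; cup_simpl;
    by rewrite ?hu' ?x1 ?hv ?hw; field; rewrite ?m1 ?m2 ?m3 ?m4.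
  rewrite s9 // h1 // Ao'; cup_simpl; ring.
- move=> f; rewrite !(cap_peel _ hk) cap_act_mid ht h2 !(Ao,Ao') s1 s5 s8.
  by rewrite x1 hv hw; field; rewrite m1 m2 m3 m4.
- rewrite (cap_peel _ hk) ht !(Ao,Ao'); cup_simpl.
  by rewrite x1 hv; field; rewrite m1 m2 m3 m4.
Qed.

(** Only two relations of [cup_inv] are assumed, and without l, so that what follows also serves
    sl(N), where cup and cap vanish. *)
Hypothesis act_cup : forall a b, mid a -> mid b ->
  braid o (act2 cup) a b = q * (act2 cup a b - c * cup a b).
Hypothesis cap_act : forall f,
  cap o (act2 (braid o f)) = q * (cap o (act2 f) - c * cap o f).

Let braid_act_mid f a b : mid a -> mid b ->
  braid o (act2 (braid k f)) a b = braid o (act2 (braid o f)) a b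
    - d * v o * f o o' * (q * (act2 cup a b - c * cup a b)).
Proof.
move=> ha hb; rewrite -act_cup // -braid_sub.
by apply: braid_ext => // i j hi hj; rewrite act_mid.
Qed.

(** On cup, A S A = q (A^2 - c A) = q p, which evaluates the cup term separating the full S from the
    inner one. *)
Let act_braid_act_mid f a b : mid a -> mid b ->
  act2 (braid o (act2 (braid k f))) a b
  = act2 (braid o (act2 (braid o f))) a b - d * v o * f o o' * (q * p * cup a b).
Proof.
move=> ha hb.
transitivity (act2 (fun i j => braid o (act2 (braid o f)) i j
  - d * v o * f o o' * q * (fun i j => act2 cup i j - c * cup i j) i j) a b).
  apply: (act2_ext hb (midsg hb)) => j hj; rewrite braid_act_mid //; ring.
by rewrite act2_sub act2_sub (act2K _ _ hA) //; ring.
Qed.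

(** The first alternative is sl(N). In the second, where u_o' v_o will be q l, the equation is the
    inner [cap_act_cup] divided by q. *)
Lemma reflection_peel :
  q != 0 -> d != 0 ->
  (w = 1 /\ forall i, u i = 0) \/
  (w = q^-1 /\
   d * (u o' * v o * cap o (act2 cup)) = q^-1 * c * (1 + q ^+ 2 * (u o' * v o))) ->
  reflection k.+1 -> reflection k.
Proof.
move=> q0 d0 hw hre f a b /inside_peel ha /inside_peel hb.
have capAA g : cap o (act2 (act2 g)) = c * cap o (act2 g) + p * cap o g.
  by rewrite -cap_lin; apply: cap_ext => i j hi hj; rewrite (act2K _ _ hA).
have quad j : mid j -> [/\ sg (sg j) = j,
    be j * be (sg j) = c * al j + p - al j ^+ 2
  & be j * al (sg j) = c * be j - al j * be j].
  by case/hA => _ -> e1 ->; split=> //; [rewrite -e1 | ]; ring.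
case: ha hb => [->|->|ha] [->|->|hb].
9: { rewrite s9 // Ao' s1 Ao braid_act_mid // hre // act_mid //.
  by rewrite act_braid_act_mid // Ao' Ao' s1 -bep; ring. }
1,2,4,5:
  repeat rewrite !(s1,s8,s4,s5,Ao,Ao',cap_act_mid,cap_act,capAA) //; rewrite -?bep.
(* At (o, o) and (o, o') the two sides differ by a multiple of the equation for cap (A cup); for
   sl(N) the terms containing it vanish with u. *)
1,2: case: hw => [[-> u0]|[-> E]]; first by rewrite u0; field.
- by apply: (lincomb2 (z := - (be o * d * f o o')) (z' := 0) E E); field.
- by apply: (lincomb2 (z := be o' * d * f o o) (z' := 0) E E); field.
- by ring.
- by ring.
1-4: try have hsa := midsg ha; try have hsb := midsg hb.
1-4: repeat rewrite !(s2,s3,s6,s7,Ao,Ao') //.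
1-2: have [ss e1 e2] := quad _ hb.
3-4: have [ss e1 e2] := quad _ ha.
1-4: rewrite /act2; repeat rewrite !(ss,sgo,sgo',alo,alo',s2,s3,s6,s7) //.
1-4: rewrite -?bep in e1.
(* With the outer leg on o, the two sides differ, up to sign, by d times a row of A^2 - c A - p
   applied to the inner leg of f. *)
- by apply: (lincomb2 (z := - d * f b o) (z' := - d * f (sg b) o) e1 e2); ring.
- by ring.
- by apply: (lincomb2 (z := d * f o a) (z' := d * f o (sg a)) e1 e2); ring.
- by ring.
Qed.

End PeelOne.

(** * Adding two pairs of outer indices to a skew A *)

Section PeelTwo.
Variables (k : nat) (c p l : K).
Hypothesis hk : (k.+2 < N - k.+1)%N.
Local Notation o1 := k.+1.
Local Notation o2 := k.+2.
Local Notation o1' := (D k.+1).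
Local Notation o2' := (D k.+2).
Local Notation mid := (inside N k.+2).
Hypothesis hh : forall a b, inside N k a -> inside N k b ->
  ~~ ((a == b) && (a == D a)) ->
  h a b = if a == b then q else if a == D b then q^-1 else 1.
Hypothesis hA : act_quadratic k.+2 c p.
Hypotheses (al1 : al o1 = c) (al2 : al o2 = c) (al1' : al o1' = 0)
  (al2' : al o2' = 0).
Hypotheses (sg1 : sg o1 = o2') (sg2 : sg o2 = o1') (sg1' : sg o1' = o2)
  (sg2' : sg o2' = o1).
Hypotheses (be2 : be o2 = - be o1) (be1' : be o1' = - be o2')
  (bep : be o1 * be o2' = p).
Hypotheses (q0 : q != 0) (d0 : d != 0) (l0 : l != 0) (u0 : u o1 != 0).
Hypotheses (u2 : u o2 = q^-1 * u o1) (u1' : u o1' = q * l * u o1)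
  (u2' : u o2' = q ^+ 2 * l * u o1) (v1 : v o1 = (u o1)^-1)
  (v2 : v o2 = q * (u o1)^-1) (v1' : v o1' = (q * l * u o1)^-1)
  (v2' : v o2' = (q ^+ 2 * l * u o1)^-1).

Let s0 f a b : inside N k a -> inside N k b -> b != D a ->
  braid k f a b
  = if a == b then q * f a a else f b a + (a < b)%N%:R * d * f a b.
Proof.
move=> ha hb /negPf hab; rewrite /braid hh ?hab //; last first.
  by apply/negP => /andP[/eqP e /eqP e']; rewrite -e {1}e' eqxx in hab.
have -> : (a == D b) = false by nlia.
by case: eqP => [<-|_]; rewrite ?ltnn /=; ring.
Qed.

Let outer_mid f b : mid b ->
  ((braid k f o1 b = f b o1 + d * f o1 b)%R * (braid k f o2 b = f b o2 + d * f o2 b)%R *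
   (braid k f o1' b = f b o1')%R * (braid k f o2' b = f b o2')%R)%type.
Proof.
by move=> hb; repeat apply: pair; rewrite s0; try nlia; decide_nat; rewrite /=; ring.
Qed.

Let mid_outer f b : mid b ->
  ((braid k f b o1 = f o1 b)%R * (braid k f b o2 = f o2 b)%R *
   (braid k f b o1' = f o1' b + d * f b o1')%R *
   (braid k f b o2' = f o2' b + d * f b o2')%R)%type.
Proof.
by move=> hb; repeat apply: pair; rewrite s0; try nlia; decide_nat; rewrite /=; ring.
Qed.

Let upper f :
  ((braid k f o1 o1 = q * f o1 o1)%R *
   (braid k f o1 o2 = f o2 o1 + d * f o1 o2)%R *
   (braid k f o1 o2' = f o2' o1 + d * f o1 o2')%R *
   (braid k f o1 o1' = q^-1 * f o1' o1 + d * f o1 o1' - d * u o1' *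
      (v o1 * f o1 o1' + v o2 * f o2 o2' + cap k.+2 f + v o2' * f o2' o2))%R *
   (braid k f o2 o1 = f o1 o2)%R *
   (braid k f o2 o2 = q * f o2 o2)%R *
   (braid k f o2 o2' = q^-1 * f o2' o2 + d * f o2 o2' - d * u o2' *
      (v o1 * f o1 o1' + v o2 * f o2 o2' + cap k.+2 f))%R *
   (braid k f o2 o1' = f o1' o2 + d * f o2 o1')%R)%type.
Proof.
repeat apply: pair; try (by rewrite s0; try nlia; decide_nat; rewrite /=; ring);
  rewrite /braid hh; try nlia.
- have -> : pairing k o1' f = v o1 * f o1 o1' + cap k.+1 f.
    by rewrite pairing_peel //; nlia.
  rewrite cap_peel; last by nlia.
  by decide_nat; rewrite /=; ring.
- rewrite (@pairing_peel k) ?(@pairing_peel k.+1); try by nlia.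
  by rewrite /cap; decide_nat; rewrite /=; ring.
Qed.

Let lower f :
  ((braid k f o2' o1 = f o1 o2')%R *
   (braid k f o2' o2 = q^-1 * f o2 o2' - d * u o2 * (v o1 * f o1 o1'))%R *
   (braid k f o2' o2' = q * f o2' o2')%R *
   (braid k f o2' o1' = f o1' o2' + d * f o2' o1')%R *
   (braid k f o1' o1 = q^-1 * f o1 o1')%R *
   (braid k f o1' o2 = f o2 o1')%R *
   (braid k f o1' o2' = f o2' o1')%R *
   (braid k f o1' o1' = q * f o1' o1')%R)%type.
Proof.
repeat apply: pair; try (by rewrite s0; try nlia; decide_nat; rewrite /=; ring);
  rewrite /braid hh; try nlia.
- rewrite pairing_peel; last by nlia.
  rewrite /pairing (big_geq (leqnn _)); decide_nat; rewrite /=; ring.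
- rewrite /pairing (big_geq (leqnn _)); decide_nat; rewrite /=; ring.
Qed.

Let s9 f a b : mid a -> mid b ->
  braid k f a b = braid k.+2 f a b
    - d * (v o1 * f o1 o1' + v o2 * f o2 o2') * cup a b.
Proof.
move=> ha hb; rewrite /braid (@pairing_peel k) ?(@pairing_peel k.+1); try by nlia.
by rewrite /cup; ring.
Qed.

Let cap2 f : cap k f = v o1 * f o1 o1' + v o2 * f o2 o2' + cap k.+2 f
  + v o2' * f o2' o2 + v o1' * f o1' o1.
Proof. by rewrite (@cap_peel k) ?(@cap_peel k.+1); try nlia; ring. Qed.

Let actE f a :
  ((act2 f a o1 = c * f a o1 + be o1 * f a o2')%R *
   (act2 f a o2 = c * f a o2 - be o1 * f a o1')%R *
   (act2 f a o1' = - be o2' * f a o2)%R * (act2 f a o2' = be o2' * f a o1)%R)%type.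
Proof.
by rewrite /act2 al1 al2 al1' al2' sg1 sg2 sg1' sg2' be2 be1'; repeat apply: pair; ring.
Qed.

Let midsg b : mid b -> mid (sg b).
Proof. by case/hA. Qed.

Let act_mid f a b : mid a -> mid b ->
  act2 (braid k f) a b = act2 (braid k.+2 f) a b
    - d * (v o1 * f o1 o1' + v o2 * f o2 o2') * act2 cup a b.
Proof. by move=> ha hb; rewrite /act2 !s9 ?midsg //; ring. Qed.

Let cap_act_mid f : cap k.+2 (act2 (braid k f)) = cap k.+2 (act2 (braid k.+2 f))
  - d * (v o1 * f o1 o1' + v o2 * f o2 o2') * cap k.+2 (act2 cup).
Proof. by rewrite -cap_sub; apply: cap_ext => i j hi hj; rewrite act_mid. Qed.

Let cup_outer :
  ((cup o1 o1 = 0)%R * (cup o1 o2 = 0)%R * (cup o1 o2' = 0)%R * (cup o1 o1' = u o1')%R *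
   (cup o2 o1 = 0)%R * (cup o2 o2 = 0)%R * (cup o2 o2' = u o2')%R * (cup o2 o1' = 0)%R *
   (cup o2' o1 = 0)%R * (cup o2' o2 = u o2)%R * (cup o2' o2' = 0)%R * (cup o2' o1' = 0)%R *
   (cup o1' o1 = u o1)%R * (cup o1' o2 = 0)%R * (cup o1' o2' = 0)%R * (cup o1' o1' = 0)%R)%type.
Proof. by repeat apply: pair; cup_simpl. Qed.

Let cup_outer_mid b : mid b ->
  ((cup o1 b = 0)%R * (cup o2 b = 0)%R * (cup o2' b = 0)%R * (cup o1' b = 0)%R *
   (cup b o1 = 0)%R * (cup b o2 = 0)%R * (cup b o2' = 0)%R * (cup b o1' = 0)%R)%type.
Proof. by move=> hb; repeat apply: pair; cup_simpl. Qed.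

Lemma inside_peel2 a : inside N k a ->
  a = o1 \/ a = o2 \/ a = o2' \/ a = o1' \/ mid a.
Proof. by case/inside_peel=> [|| /inside_peel[]]; auto. Qed.

Hypothesis mid_inv : cup_inv k.+2 (q ^+ 4 * l) (- q^-1) c.

Let cap_act_cup_mid :
  cap k.+2 (act2 cup) = c * (1 + - q^-1 * (q ^+ 4 * l)) / (d * (q ^+ 4 * l)).
Proof.
by rewrite -(cap_act_cup mid_inv) mulrAC mulfV ?mul1r // !mulf_neq0 ?expf_neq0.
Qed.

(** The off-diagonal part of A contributes to A cup a multiple of q e_o2 (x) e_o1 - e_o1 (x) e_o2,
    because u_o2' = q u_o1' and [be] changes sign between o1 and o2. On this vector S is -1/q, and
    the primed indices behave alike. *)
Lemma cup_inv_peel2 : cup_inv k l (- q^-1) c.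
Proof.
have [h1 h2 _] := mid_inv.
have [m1 m2 m3 m4] := And4 u0 q0 l0 (sqrB1_neq0 q0 d0).
split.
{ move=> a b /inside_peel2 ha /inside_peel2 hb.
  case: ha => [->|[->|[->|[->|ha]]]]; case: hb => [->|[->|[->|[->|hb]]]].
  25: by rewrite s9 // h1 // !actE !cup_outer; ring.
  all: try have hsa := midsg ha; try have hsb := midsg hb;
    rewrite !(upper,lower,mid_outer,outer_mid) // ?cap_act_cup_mid ?actE ?/act2
      ?cup_outer ?cup_outer_mid //.
  all: by rewrite ?(u2,u1',u2',v1,v2,v1',v2'); field; rewrite ?m1 ?m2 ?m3 ?m4. }
- move=> f; rewrite !cap2 cap_act_mid cap_act_cup_mid h2 !actE !(upper,lower).
  by rewrite ?(u2,u1',u2',v1,v2,v1',v2'); field; rewrite ?m1 ?m2 ?m3 ?m4.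
- rewrite cap2 cap_act_cup_mid !actE !cup_outer.
  by rewrite ?(u2,u1',u2',v1,v2,v1',v2'); field; rewrite ?m1 ?m2 ?m3 ?m4.
Qed.

Let braid_act_mid f a b : mid a -> mid b ->
  braid k.+2 (act2 (braid k f)) a b = braid k.+2 (act2 (braid k.+2 f)) a b
    - d * (v o1 * f o1 o1' + v o2 * f o2 o2')
      * (- q^-1 * (act2 cup a b - c * cup a b)).
Proof.
move=> ha hb; rewrite -(braid_act_cup mid_inv) // -braid_sub.
by apply: braid_ext => // i j hi hj; rewrite act_mid.
Qed.

Let act_braid_act_mid f a b : mid a -> mid b ->
  act2 (braid k.+2 (act2 (braid k f))) a b
  = act2 (braid k.+2 (act2 (braid k.+2 f))) a b
    - d * (v o1 * f o1 o1' + v o2 * f o2 o2') * (- q^-1 * p * cup a b).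
Proof.
move=> ha hb.
transitivity (act2 (fun i j => braid k.+2 (act2 (braid k.+2 f)) i j
    - d * (v o1 * f o1 o1' + v o2 * f o2 o2') * - q^-1
      * (fun i j => act2 cup i j - c * cup i j) i j) a b).
  by apply: (act2_ext hb (midsg hb)) => j hj; rewrite braid_act_mid //; ring.
by rewrite act2_sub act2_sub (act2K _ _ hA) //; ring.
Qed.

Lemma reflection_peel2 : reflection k.+2 -> reflection k.
Proof.
move=> hre f a b /inside_peel2 ha /inside_peel2 hb.
have [m1 m2 m3 m4] := And4 u0 q0 l0 (sqrB1_neq0 q0 d0).
have capAA g :
    cap k.+2 (act2 (act2 g)) = c * cap k.+2 (act2 g) + p * cap k.+2 g.
  by rewrite -cap_lin; apply: cap_ext => i j hi hj; rewrite (act2K _ _ hA).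
have quad j : mid j -> [/\ sg (sg j) = j,
    be j * be (sg j) = c * al j + be o1 * be o2' - al j ^+ 2
  & be j * al (sg j) = c * be j - al j * be j].
  by case/hA => _ -> e1 ->; split=> //; [rewrite bep -e1 | ]; ring.
have outE := (upper, lower, actE, cap_act_mid, cap_act_braid mid_inv, capAA).
have midE := (outer_mid, mid_outer, actE).
have uvE := (u2, u1', u2', v1, v2, v1', v2').
case: ha => [->|[->|[->|[->|ha]]]]; case: hb => [->|[->|[->|[->|hb]]]].
25: { rewrite s9 // !actE braid_act_mid // hre // act_mid // act_braid_act_mid //.
  by rewrite -bep; repeat rewrite !outE; rewrite !uvE; field; rewrite m1 m2. }
1-4,6-9,11-14,16-19: repeat rewrite !outE.
1-16: by rewrite ?cap_act_cup_mid -?bep ?uvE; field; rewrite ?m1 ?m2 ?m3 ?m4.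
1-4: have [ss e1 e2] := quad _ hb; have hsb := midsg hb.
5-8: have [ss e1 e2] := quad _ ha; have hsa := midsg ha.
1-8: repeat rewrite !midE //.
1-8: rewrite /act2;
  repeat rewrite !(ss, sg1, sg2, sg1', sg2', al1, al2, al1', al2', be2, be1', midE) //.
(* As for one pair, an outer leg on o1 or o2 leaves d times a row of A^2 - c A - p, up to sign. *)
1: apply: (lincomb2 (z := - d * f b o1) (z' := - d * f (sg b) o1) e1 e2).
2: apply: (lincomb2 (z := - d * f b o2) (z' := - d * f (sg b) o2) e1 e2).
5: apply: (lincomb2 (z := d * f o1 a) (z' := d * f o1 (sg a)) e1 e2).
6: apply: (lincomb2 (z := d * f o2 a) (z' := d * f o2 (sg a)) e1 e2).
all: by ring.
Qed.

End PeelTwo.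

(** * From the middle of A to all indices *)

Lemma reflection_descent_linear c p m : q != 0 -> d != 0 -> (2 * m <= N)%N ->
  (forall i, u i = 0) -> (forall i, v i = 0) ->
  (forall a b, h a b = if a == b then q else 1) ->
  (forall k, (k < m)%N ->
     [/\ act_quadratic k.+1 c p, al k.+1 = c, al (D k.+1) = 0,
         be k.+1 * be (D k.+1) = p & sg k.+1 = D k.+1 /\ sg (D k.+1) = k.+1]) ->
  reflection m -> reflection 0.
Proof.
move=> q0 d0 hm u0 v0 hh.
have cup0 a b : cup a b = 0 by rewrite /cup u0 mulr0.
have act_cup0 a b : act2 cup a b = 0 by rewrite /act2 !cup0 !mulr0 addr0.
have cap0 k f : cap k f = 0.
  by rewrite /cap /pairing big1 // => i _; rewrite v0 mul0r.
have braid_act_cup0 k a b : braid k (act2 cup) a b = 0.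
  rewrite /braid !act_cup0 u0; ring.
elim: m hm => [|m IH] // hm ho hr; have hk : (m.+1 < N - m)%N by lia.
have [hA e1 e2 e3 [e4 e5]] := ho m (ltnSn m).
apply: IH => [|k km|]; [lia | by apply: ho; lia | ].
have hh' a b : inside N m a -> inside N m b -> ~~ ((a == b) && (a == D a)) ->
  h a b = if a == b then q else if a == D b then 1 else 1.
  by rewrite hh; case: ifP => // _; case: ifP.
apply: (reflection_peel hk hh' hA e1 e2 e3 e4 e5 _ _ q0 d0 _ hr).
- by move=> a b _ _; rewrite braid_act_cup0 act_cup0 cup0; ring.
- by move=> f; rewrite !cap0; ring.
- by left.
Qed.

Section Descent.
Variable lam : nat -> K.
Hypotheses (q0 : q != 0) (d0 : d != 0) (lam0 : forall k, lam k != 0)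
  (lamS : forall k, lam k.+1 = q ^+ 2 * lam k).

Hypothesis hw : dual_weights lam.
Hypothesis hh : forall a b, inside N 0 a -> inside N 0 b ->
  ~~ ((a == b) && (a == D a)) ->
  h a b = if a == b then q else if a == D b then q^-1 else 1.

Let hhk k a b : inside N k a -> inside N k b -> ~~ ((a == b) && (a == D a)) ->
  h a b = if a == b then q else if a == D b then q^-1 else 1.
Proof. by move=> ha hb; apply: hh; nlia. Qed.

(** Serves the matrices with zero diagonal: on an empty middle, [cap_act_cup] reads 0 = c (1 + mu
    l). *)
Lemma cup_inv_empty k l mu : (D k <= k.+1)%N -> cup_inv k l mu 0.
Proof.
move=> hk; split.
- by move=> a b ha hb; nlia.
- by move=> f; rewrite !cap_empty // mulr0 subr0 mulr0.
- by rewrite cap_empty // mulr0 mul0r.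
Qed.

Lemma reflection_empty k : (D k <= k.+1)%N -> reflection k.
Proof. by move=> hk f a b ha hb; nlia. Qed.

Section Scalar.
Variables (k : nat) (r : K).
Hypothesis hal : forall i, inside N k i -> al i = r.
Hypothesis hbe : forall i, inside N k i -> be i = 0.

Let actE f a b : inside N k b -> act2 f a b = r * f a b.
Proof. by move=> hb; rewrite /act2 hal // hbe // mul0r addr0. Qed.

Let braidZ f a b : inside N k a -> inside N k b ->
  braid k (act2 f) a b = r * braid k f a b.
Proof.
move=> ha hb.
(* Scaling by r is written as a difference so that [braid_sub] applies. *)
transitivity (braid k (fun i j => 0 * f i j - (- r) * f i j) a b).
  by apply: braid_ext => // i j hi hj; rewrite actE //; ring.
rewrite (braid_sub k (fun i j => 0 * f i j)).
suff -> : braid k (fun i j => 0 * f i j) a b = 0 by ring.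
rewrite /braid /pairing big1 => [|i _]; by [ring | rewrite mul0r mulr0].
Qed.

Lemma reflection_scalar : reflection k.
Proof.
by move=> f a b ha hb; rewrite braidZ // actE //; congr (_ * _);
  apply: braid_ext => // i j hi hj; rewrite braidZ // actE.
Qed.

(** With r = q^-m and l = mu q^(-N+2m), the hypothesis on r gives c = q^-m (1 - q^(-N+2m)), the
    diagonal coefficient in the theorem. Since mu - 1/mu = d, the number 1 + d l - l^2 factors as
    (mu - l)(1 + mu l) / mu, which turns [cap_cup] into [cap_act_cup]. *)
Lemma cup_inv_scalar l mu c : braid_inv k l -> l * r = mu * (r - c) ->
  mu != 0 -> mu ^+ 2 = d * mu + 1 -> cup_inv k l mu c.
Proof.
move=> [_ h2 h3 h4] hr mu0 hmu.
have capE f : cap k (act2 f) = r * cap k f.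
  rewrite -[RHS]addr0 -(mul0r (cap k f)) -cap_lin.
  by apply: cap_ext => i j hi hj; rewrite actE //; ring.
split.
- by move=> a b ha hb; rewrite braidZ // h3 // actE // mulrA (mulrC r) hr; ring.
- by move=> f; rewrite !capE h2 mulrA (mulrC r) hr; ring.
- rewrite capE mulrCA h4; apply: (mulfI mu0).
  by apply: (lincomb2 (z := - (1 + mu * l)) (z' := - (l * r)) hr hmu); ring.
Qed.

End Scalar.

(* The innermost pair of indices of so(N) when N / 2 is odd: there A is
   diag(z, -z). *)
Section Pair.
Variable k : nat.
Hypothesis hk : D k = k.+3.
Local Notation o := k.+1.
Local Notation o' := k.+2.
Hypotheses (alo : al o = 0) (alo' : al o' = 0) (sgo : sg o = o)
  (sgo' : sg o' = o') (beo : be o' = - be o).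
Hypotheses (uo : u o = 1) (uo' : u o' = 1) (vo : v o = 1) (vo' : v o' = 1).

Let Do : D o = o'. Proof. by nlia. Qed.
Let Do' : D o' = o. Proof. by nlia. Qed.

Let insideE a : inside N k a -> a = o \/ a = o'.
Proof. by move=> ha; nlia. Qed.

Let capE f : cap k f = f o o' + f o' o.
Proof.
rewrite /cap /pairing hk big_nat_recl //= big_nat1 vo.
by rewrite Do vo' Do' !mul1r.
Qed.

Let actE f a : ((act2 f a o = be o * f a o)%R * (act2 f a o' = - be o * f a o')%R)%type.
Proof. by rewrite /act2 alo alo' sgo sgo' beo !mul0r !add0r. Qed.

Let cupE : ((cup o o = 0)%R * (cup o o' = 1)%R * (cup o' o = 1)%R * (cup o' o' = 0)%R)%type.
Proof.
rewrite /cup Do Do' !eqxx uo uo' !mul1r (_ : (o == o') = false); last by lia.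
by rewrite (_ : (o' == o) = false) ?mul0r //; lia.
Qed.

Let braidE f : ((braid k f o o = q * f o o)%R * (braid k f o o' = q^-1 * f o' o)%R *
  (braid k f o' o = q^-1 * f o o')%R * (braid k f o' o' = q * f o' o')%R)%type.
Proof.
have hk' : (o < N - k)%N by nlia.
have := (braid_oo hk' (@hhk k) f, braid_oo' hk' (@hhk k) f,
  braid_o'o hk' (@hhk k) f, braid_o'o' hk' (@hhk k) f).
rewrite Do => -[[[-> ->] ->] ->]; rewrite uo' vo cap_empty; last by nlia.
by do !split; ring.
Qed.

Lemma cup_inv_pair l : cup_inv k l (- q^-1) 0.
Proof.
split.
- move=> a b /insideE[->|->] /insideE[->|->];
  by rewrite !braidE !actE !cupE; ring.
- by move=> f; rewrite !capE !actE !braidE; ring.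
- by rewrite capE !actE !cupE; ring.
Qed.

Lemma reflection_pair : reflection k.
Proof.
move=> f a b /insideE[->|->] /insideE[->|->];
  by do ! rewrite ?braidE ?actE; ring.
Qed.

End Pair.

(** [cup_inv] is carried along with the reflection equation because each step of the latter uses the
    value of cap (A cup) on the indices already covered. *)
Lemma reflection_descent1 c p m : (2 * m <= N)%N ->
  (forall k, (k < m)%N ->
     [/\ act_quadratic k.+1 c p, al k.+1 = c, al (D k.+1) = 0,
         be k.+1 * be (D k.+1) = p & sg k.+1 = D k.+1 /\ sg (D k.+1) = k.+1]) ->
  cup_inv m (lam m) q c -> reflection m -> cup_inv 0 (lam 0) q c /\ reflection 0.
Proof.
elim: m => [|m IH] // hm ho h1 h2; have hk : (m.+1 < N - m)%N by lia.
have [hA e1 e2 e3 [e4 e5]] := ho m (ltnSn m).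
have [x1 x2 x3 x4] := hw hk.
rewrite lamS in h1; have [_ _ ht] := h1.
apply: IH => [|k km||]; [lia | by apply: ho; lia | | ].
  exact: (cup_inv_peel hk (@hhk m) hA e1 e2 e4 e5 q0 d0 (lam0 m) erefl x1 x2 x3 x4 h1).
have [g1 g2 _] := h1.
apply: (reflection_peel hk (@hhk m) hA e1 e2 e3 e4 e5 g1 g2 q0 d0 _ h2).
right; split=> //; rewrite x3 x2.
have side : q * lam m != 0 by rewrite mulf_neq0.
have -> : q * lam m * u m.+1 / u m.+1 = q * lam m by rewrite mulfK.
apply: (mulfI q0).
by apply: (lincomb2 (z := 1) (z' := 0) ht ht); field.
Qed.

Lemma reflection_descent2 c p m : (4 * m <= N)%N ->
  (forall k, (k.+2 < N - k.+1)%N -> u k.+2 = q^-1 * u k.+1) ->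
  (forall j, (j < m)%N -> let k := (2 * j)%N in
     [/\ act_quadratic k.+2 c p,
         [/\ al k.+1 = c, al k.+2 = c, al (D k.+1) = 0 & al (D k.+2) = 0],
         [/\ sg k.+1 = D k.+2, sg k.+2 = D k.+1, sg (D k.+1) = k.+2
           & sg (D k.+2) = k.+1],
         be k.+2 = - be k.+1 /\ be (D k.+1) = - be (D k.+2)
       & be k.+1 * be (D k.+2) = p]) ->
  cup_inv (2 * m) (lam (2 * m)) (- q^-1) c -> reflection (2 * m) ->
  cup_inv 0 (lam 0) (- q^-1) c /\ reflection 0.
Proof.
move=> hm hu ho; elim: m hm ho => [|m IH] hm ho; first by rewrite muln0.
have -> : (2 * m.+1 = (2 * m).+2)%N by lia.
move=> h1 h2; set k := (2 * m)%N in h1 h2; have hk : (k.+2 < N - k.+1)%N by lia.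
have [hA [e1 e2 e3 e4] [s1 s2 s3 s4] [b1 b2] b3] := ho m (ltnSn m).
have [x1 x2 x3 x4] := hw (ltac:(lia) : (k.+1 < N - k)%N).
have [y1 y2 y3 y4] := hw hk.
have u2 := hu k hk.
have z2 : v k.+2 = q * (u k.+1)^-1 by rewrite y2 u2 invfM invrK.
have z3 : u (D k.+2) = q ^+ 2 * lam k * u k.+1.
  by rewrite y3 u2 lamS; field.
rewrite !lamS mulrA -exprD in h1.
apply: IH => [|j jm||]; [lia | by apply: ho; lia | | ].
- apply: (cup_inv_peel2 hk (@hhk k) hA e1 e2 e3 e4 s1 s2 s3 s4 b1 b2 q0 d0
    (lam0 k) x1 u2 x3 z3 x2 z2 _ _ h1); by rewrite ?x4 ?x3 ?y4 ?z3.
- apply: (reflection_peel2 hk (@hhk k) hA e1 e2 e3 e4 s1 s2 s3 s4 b1 b2 b3 q0 d0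
    (lam0 k) x1 u2 x3 z3 x2 z2 _ _ h1 h2); by rewrite ?x4 ?x3 ?y4 ?z3.
Qed.

End Descent.
End Tensors.

(** * From coordinates to matrices *)

Section Matrices.
Variables (K : numFieldType) (n : nat).
Local Notation N := n.+1.
Implicit Types (X : 'cV[K]_(N * N)) (M : 'M[K]_(N * N)).
Implicit Types (f g : nat -> nat -> K) (T : (nat -> nat -> K) -> nat -> nat -> K).

(** A row y in both the eigenspace and the image of T - l is killed by W, as (T - l) W = 0, and by 1
    - W = (T - l) Z; so the sum is direct. Then [proj_mx] fixes W, whose rows are eigenvectors, and
    kills 1 - W, whose rows lie in the image. The relations are two-sided, so W is the spectral
    projector on columns as well. *)
Lemma spectral_projectorE (m : nat) (l : K) (T W Z : 'M[K]_m) :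
  W *m (T - l%:M) = 0 -> (T - l%:M) *m W = 0 -> 1%:M - W = Z *m (T - l%:M) ->
  1%:M - W = (T - l%:M) *m Z -> spectral_projector T l = W.
Proof.
move=> WT TW eZ eZ'; rewrite /spectral_projector.
have WE : (W <= eigenspace T l)%MS by rewrite /eigenspace; apply/sub_kermxP.
have cap00 : (eigenspace T l :&: (T - l%:M) = 0)%MS.
  apply/eqP; rewrite -submx0; apply/rV_subP => y; rewrite sub_capmx.
  move=> /andP[/sub_kermxP yT /submxP[z ez]].
  have -> : y = y *m W + y *m (1%:M - W) by rewrite -mulmxDr addrC subrK mulmx1.
  by rewrite {1}ez -mulmxA TW eZ' mulmxA yT mulmx0 mul0mx addr0 sub0mx.
have e1 := proj_mx_id cap00 WE.
have e2 : (1%:M - W) *m proj_mx (eigenspace T l) (T - l%:M) = 0.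
  by apply: (proj_mx_0 cap00); rewrite eZ submxMl.
by rewrite -[RHS]e1 -[LHS]mul1mx -[X in X *m _ = _](subrK W) mulmxDl e2 add0r.
Qed.

Definition coord X a b : K := X (mxtens_index (inord a.-1, inord b.-1)) 0.

(* M acts on coordinates as T; only the values of T on indices 1..N matter. *)
Definition represents M T := forall X f,
  (forall a b, inside N 0 a -> inside N 0 b -> coord X a b = f a b) ->
  forall a b, inside N 0 a -> inside N 0 b -> coord (M *m X) a b = T f a b.

Lemma represents_inj M M' T T' : represents M T -> represents M' T' ->
  (forall f a b, inside N 0 a -> inside N 0 b -> T f a b = T' f a b) -> M = M'.
Proof.
move=> hM hM' e; apply/matrixP => i j; case: (mxtens_indexP i) => i1 i2.
have inI (k : 'I_N) : inside N 0 k.+1 by have := ltn_ord k; nlia.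
have colE0 (L : 'M_(N * N)) : L (mxtens_index (i1, i2)) j
    = coord (L *m delta_mx j 0) i1.+1 i2.+1.
  by rewrite /coord !inord_val -colE mxE.
rewrite !colE0; rewrite (hM _ (coord (delta_mx j 0))) // e //.
by rewrite (hM' _ (coord (delta_mx j 0))).
Qed.

Lemma represents_mul M M' T T' : represents M T -> represents M' T' ->
  represents (M *m M') (fun f => T (T' f)).
Proof.
move=> hM hM' X f e a b ha hb; rewrite -mulmxA; apply: hM => //.
exact: hM'.
Qed.

Lemma represents_add M M' T T' : represents M T -> represents M' T' ->
  represents (M + M') (fun f a b => T f a b + T' f a b).
Proof.
move=> hM hM' X f e a b ha hb.
by rewrite mulmxDl /coord mxE -!/(coord _ _ _) (hM _ f) // (hM' _ f).
Qed.

Lemma represents_scale x M T : represents M T ->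
  represents (x *: M) (fun f a b => x * T f a b).
Proof.
move=> hM X f e a b ha hb.
by rewrite -scalemxAl /coord mxE -!/(coord _ _ _) (hM _ f).
Qed.

Lemma represents_sum (r : seq nat) (P : pred nat) (F : nat -> 'M_(N * N))
    (T : nat -> (nat -> nat -> K) -> nat -> nat -> K) :
  (forall i, i \in r -> represents (F i) (T i)) ->
  represents (\sum_(i <- r | P i) F i) (fun f a b => \sum_(i <- r | P i) T i f a b).
Proof.
move=> hF X f e a b ha hb; rewrite mulmx_suml /coord summxE.
rewrite big_seq_cond [RHS]big_seq_cond; apply: eq_bigr => i /andP[ir _].
by rewrite -/(coord _ _ _) (hF _ ir _ f).
Qed.

Lemma coord_tens (A B : 'M[K]_N) X a b : coord ((A *t B) *m X) a b
  = \sum_(c < N) \sum_(d < N)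
      A (inord a.-1) c * B (inord b.-1) d * coord X c.+1 d.+1.
Proof.
rewrite /coord mxE (reindex (@mxtens_index N N)) /=; last first.
  by exists (@mxtens_unindex N N) => x _; rewrite (mxtens_indexK, mxtens_unindexK).
rewrite pair_bigA; apply: eq_bigr => -[c d] _ /=.
by rewrite tensmxE !inord_val.
Qed.

Lemma sum_pick_ord (F : nat -> K) j : inside N 0 j ->
  \sum_(c < N) (c.+1 == j)%:R * F c.+1 = F j.
Proof.
move=> hj; have lt : (j.-1 < N)%N by nlia.
have ej : j = (Ordinal lt).+1 by rewrite /=; nlia.
rewrite (bigD1 (Ordinal lt)) //= -ej eqxx mul1r big1 ?addr0 // => c hc.
by rewrite ej eqSS (_ : (val c == Ordinal lt) = false) ?mul0r //; apply: negPf.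
Qed.

Lemma inord_pred a : inside N 0 a -> ((inord a.-1 : 'I_N) : nat).+1 = a.
Proof. by move=> ha; rewrite inordK; nlia. Qed.

Lemma represents_munit i j k l : inside N 0 j -> inside N 0 l ->
  represents (munit K N i j *t munit K N k l)
    (fun f a b => (a == i)%:R * ((b == k)%:R * f j l)).
Proof.
move=> hj hl X f e a b ha hb; rewrite coord_tens.
rewrite -(e _ _ hj hl) -(sum_pick_ord (fun x => coord X x l) hj) !mulr_sumr.
apply: eq_bigr => c _.
rewrite -(sum_pick_ord (fun x => coord X c.+1 x) hl) !mulr_sumr.
apply: eq_bigr => x _; rewrite !mxE !inord_pred // -!mulnb !natrM -!mulrA.
by congr (_ * _); exact: mulrCA.
Qed.

Lemma sum_pick (P : pred nat) (F : nat -> K) a : inside N 0 a ->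
  \sum_(1 <= i < N.+1 | P i) (a == i)%:R * F i = (P a)%:R * F a.
Proof.
move=> ha; rewrite big_mkcond /= (bigD1_seq a) ?iota_uniq //=; last first.
  by rewrite mem_index_iota; nlia.
rewrite eqxx mul1r big1 ?addr0 => [|i ia]; first by case: (P a); rewrite ?mul1r ?mul0r.
by rewrite eq_sym (negPf ia) mul0r; case: ifP.
Qed.

Lemma represents_sum1 (P : pred nat) (F : nat -> 'M[K]_(N * N))
    (T : nat -> (nat -> nat -> K) -> nat -> nat -> K) :
  (forall i, inside N 0 i -> represents (F i) (T i)) ->
  represents (\sum_(1 <= i < N.+1 | P i) F i)
    (fun f a b => \sum_(1 <= i < N.+1 | P i) T i f a b).
Proof.
move=> h; apply: represents_sum => i hi; apply: h.
by move: hi; rewrite mem_index_iota; nlia.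
Qed.

Lemma represents_sum2 (P : nat -> pred nat) (F : nat -> nat -> 'M[K]_(N * N))
    (T : nat -> nat -> (nat -> nat -> K) -> nat -> nat -> K) :
  (forall i j, inside N 0 i -> inside N 0 j -> represents (F i j) (T i j)) ->
  represents (\sum_(1 <= i < N.+1) \sum_(1 <= j < N.+1 | P i j) F i j)
    (fun f a b => \sum_(1 <= i < N.+1) \sum_(1 <= j < N.+1 | P i j) T i j f a b).
Proof.
move=> h; by apply: (represents_sum1 xpredT) => i hi; apply: represents_sum1 => j; apply: h.
Qed.

Lemma represents_flip : represents (flip K N) (fun f a b => f b a).
Proof.
have r := represents_sum2 (fun _ => xpredT)
  (fun i j hi hj => represents_munit i j hj hi).
move=> X f e a b ha hb; rewrite (r _ f) //.
under eq_bigr do rewrite -mulr_sumr sum_pick // mul1r.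
by rewrite sum_pick // mul1r.
Qed.

Lemma represents_sub M M' T T' : represents M T -> represents M' T' ->
  represents (M - M') (fun f a b => T f a b - T' f a b).
Proof.
move=> hM hM' X f e a b ha hb.
by rewrite mulmxBl /coord mxE [X in _ + X]mxE -!/(coord _ _ _) (hM _ f) // (hM' _ f).
Qed.

Lemma sum_pick2 (P : nat -> pred nat) (F G : nat -> nat -> K) a b :
  inside N 0 a -> inside N 0 b ->
  (forall i j, F i j = (a == i)%:R * ((b == j)%:R * G i j)) ->
  \sum_(1 <= i < N.+1) \sum_(1 <= j < N.+1 | P i j) F i j = (P a b)%:R * G a b.
Proof.
move=> ha hb e.
transitivity (\sum_(1 <= i < N.+1) (a == i)%:R * ((P i b)%:R * G i b)).
  by apply: eq_bigr => i _; rewrite -sum_pick // mulr_sumr; apply: eq_bigr.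
by rewrite sum_pick // mul1r.
Qed.

Definition weight (g : lie_type) (s : K) (i : nat) : K :=
  if g is SL then 0 else (kappa g N i)%:~R * s ^ rho2 g N i.

Definition coweight (g : lie_type) (s : K) (i : nat) : K :=
  if g is SL then 0 else (kappa g N i)%:~R * s ^ (- rho2 g N i).

(** The exponent is that of R at (b, a), since S = P R exchanges the two legs. *)
Definition exchange (g : lie_type) (q : K) (a b : nat) : K :=
  if g is SL then (if a == b then q else 1)
  else q ^ ((b == a)%:Z - (b == dual N a)%:Z).

Section Operators.
Variables (g : lie_type) (q s : K).
Hypothesis s0 : s != 0.
Local Notation u := (weight g s).
Local Notation v := (coweight g s).
Local Notation h := (exchange g q).
Local Notation braid0 := (braid N q u v h 0).
Local Notation cap0 := (cap N v 0).
Local Notation cup0 := (cup N u).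

Let dualI i : inside N 0 i -> inside N 0 (dual N i).
Proof. by nlia. Qed.

Lemma represents_Rmat_linear : g = SL ->
  represents (Rmat g N q s) (fun f a b => braid0 f b a).
Proof.
move=> -> X f e a b ha hb.
have r := represents_add (represents_add (represents_scale q
    (represents_sum1 xpredT (fun i hi => represents_munit i i hi hi)))
    (represents_sum2 (fun i j => i != j)
      (fun i j hi hj => represents_munit i j hi hj)))
    (represents_scale (q - q^-1)
      (represents_sum2 (fun i j => i < j)%N
        (fun i j hi hj => represents_munit j i hi hj))).
rewrite /Rmat (r _ f) // /braid /exchange /weight /=. rewrite mulr0 mul0r subr0.
rewrite sum_pick // mul1r (sum_pick2 _ ha hb (G := f)) //.
have -> : \sum_(1 <= i < N.+1) \sum_(1 <= j < N.+1 | (i < j)%N)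
    (a == j)%:R * ((b == i)%:R * f i j) = (b < a)%N%:R * f b a.
  by apply: sum_pick2 => // i j; rewrite ![(a == j)%:R * _]mulrCA.
rewrite [a == b]eq_sym; case: eqVneq => [->|_] /=; ring.
Qed.

Let weight_coweight i j : g <> SL ->
  (kappa g N i * kappa g N j)%:~R * s ^ (rho2 g N i - rho2 g N j) = u i * v j.
Proof.
move=> gSL; rewrite /weight /coweight; case: g gSL => // _;
  by rewrite intrM expfzDr //; ring.
Qed.

Lemma represents_Rmat_orthosymplectic : g <> SL ->
  represents (Rmat g N q s) (fun f a b => braid0 f b a).
Proof.
move=> gSL X f e a b ha hb.
have r := represents_add
    (represents_sum2 (fun _ => xpredT) (fun i j hi hj => represents_scale
      (q ^ ((i == j)%:Z - (i == dual N j)%:Z)) (represents_munit i j hi hj)))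
    (represents_scale (q - q^-1)
      (represents_sum2 (fun i j => j < i)%N (fun i j hi hj =>
        represents_sub (represents_munit i j hj hi) (represents_scale
          ((kappa g N i * kappa g N j)%:~R * s ^ (rho2 g N i - rho2 g N j))
          (represents_munit i (dual N i) hj (dualI hj)))))).
have -> : coord (Rmat g N q s *m X) a b
    = \sum_(1 <= i < N.+1) \sum_(1 <= j < N.+1)
        q ^ ((i == j)%:Z - (i == dual N j)%:Z)
          * ((a == i)%:R * ((b == j)%:R * f i j))
      + (q - q^-1) * \sum_(1 <= i < N.+1) \sum_(1 <= j < N.+1 | (j < i)%N)
          ((a == i)%:R * ((b == j)%:R * f j i)
           - (kappa g N i * kappa g N j)%:~R * s ^ (rho2 g N i - rho2 g N j)
             * ((a == i)%:R * ((b == dual N i)%:R * f j (dual N j)))).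
  rewrite -(r X f e a b ha hb); by case: g gSL.
rewrite (sum_pick2 _ ha hb (G := fun i j =>
  q ^ ((i == j)%:Z - (i == dual N j)%:Z) * f i j)) //; last by move=> i j; ring.
have -> : \sum_(1 <= i < N.+1) \sum_(1 <= j < N.+1 | (j < i)%N)
          ((a == i)%:R * ((b == j)%:R * f j i)
           - (kappa g N i * kappa g N j)%:~R * s ^ (rho2 g N i - rho2 g N j)
             * ((a == i)%:R * ((b == dual N i)%:R * f j (dual N j))))
  = (b < a)%N%:R * f b a - (b == dual N a)%:R * u a * pairing N v 0 a f.
  transitivity (\sum_(1 <= i < N.+1) (a == i)%:R * ((b < i)%N%:R * f b i
     - (b == dual N i)%:R * u i * pairing N v 0 i f)).
    apply: eq_big_nat => i hi; rewrite big_split /= mulrBr.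
    congr (_ + _); first by rewrite -mulr_sumr sum_pick.
    rewrite sumrN; congr (- _).
    transitivity (\sum_(1 <= j < N.+1 | (j < i)%N)
      (a == i)%:R * ((b == dual N i)%:R * u i) * (v j * f j (dual N j))).
      by apply: eq_bigr => j _; rewrite weight_coweight //; ring.
    rewrite -mulr_sumr [RHS]mulrA; congr (_ * _).
    by rewrite /pairing [RHS](big_nat_widen _ _ N.+1) //; lia.
  by rewrite sum_pick // mul1r.
rewrite mul1r /braid (_ : h b a = q ^ ((a == b)%:Z - (a == dual N b)%:Z));
  last by rewrite /exchange; case: g gSL.
have -> : (b == dual N a) = (a == dual N b) by nlia.
ring.
Qed.

Lemma represents_Rmat : represents (Rmat g N q s) (fun f a b => braid0 f b a).
Proof.
by case: (g) represents_Rmat_linear represents_Rmat_orthosymplectic => h1 h2;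
  [exact: h1 | exact: h2 | exact: h2].
Qed.

Section Point.
Variables (A : 'M[K]_N) (al be : nat -> K) (sg : nat -> nat).
Hypothesis entries : forall i j : 'I_N, A i j
  = (j.+1 == i.+1)%:R * al i.+1 + (j.+1 == sg i.+1)%:R * be i.+1.
Hypothesis sgI : forall i, inside N 0 i -> inside N 0 (sg i).
Local Notation act := (act2 al be sg).

Let sum_entries (F : nat -> K) a : inside N 0 a ->
  \sum_(c < N) A (inord a.-1) c * F c.+1 = al a * F a + be a * F (sg a).
Proof.
move=> ha; rewrite -(sum_pick_ord F ha) -(sum_pick_ord F (sgI ha)).
rewrite !mulr_sumr -big_split; apply: eq_bigr => c _.
by rewrite entries !inord_pred //=; ring.
Qed.

Let sum_delta (F : nat -> K) a : inside N 0 a ->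
  \sum_(c < N) (1%:M : 'M[K]_N) (inord a.-1) c * F c.+1 = F a.
Proof.
move=> ha; rewrite -(sum_pick_ord F ha); apply: eq_bigr => c _.
by rewrite mxE -[_ == c]eqSS inord_pred // eq_sym.
Qed.

Lemma represents_snd : represents (snd_leg A) act.
Proof.
move=> X f e a b ha hb; rewrite coord_tens.
under eq_bigr do under eq_bigr do rewrite -mulrA.
under eq_bigr => c _ do rewrite -mulr_sumr (sum_entries (fun x => coord X c.+1 x) hb).
rewrite (sum_delta (fun c => al b * coord X c b + be b * coord X c (sg b)) ha).
by rewrite !e // sgI.
Qed.

Lemma represents_fst : represents (fst_leg A)
  (fun f a b => al a * f a b + be a * f (sg a) b).
Proof.
move=> X f e a b ha hb; rewrite coord_tens.
under eq_bigr do under eq_bigr do rewrite -mulrA.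
under eq_bigr => c _ do rewrite -mulr_sumr (sum_delta (fun x => coord X c.+1 x) hb).
by rewrite (sum_entries (fun c => coord X c b) ha) !e // sgI.
Qed.

Lemma represents_Smat : represents (Smat g N q s) braid0.
Proof.
have r := represents_mul represents_flip represents_Rmat.
by move=> X f e a b ha hb; rewrite (r _ f).
Qed.

(** As R21 = S P, R12 = P S and P A_1 P = A_2, the flips cancel: in coordinates the two sides are S
    A S A and A S A S by mere computation. *)
Lemma reflection_equation_point :
  reflection N q u v h al be sg 0 -> reflection_equation g q s A.
Proof.
move=> hr; have rR := represents_Rmat.
have r21 := represents_mul (represents_mul represents_flip rR) represents_flip.
apply: (represents_inj (represents_mul (represents_mul (represents_mul r21
    represents_fst) rR) represents_snd) (represents_mul (represents_mul
    (represents_mul represents_snd r21) represents_fst) rR)).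
by move=> f a b ha hb; apply: hr.
Qed.

Definition cupcap : 'M[K]_(N * N) :=
  \sum_(1 <= i < N.+1) \sum_(1 <= j < N.+1)
    (u (dual N i) * v j) *: (munit K N i j *t munit K N (dual N i) (dual N j)).

Lemma represents_cupcap : represents cupcap (fun f a b => cup0 a b * cap0 f).
Proof.
have r := represents_sum2 (fun _ => xpredT) (fun i j hi hj =>
  represents_scale (u (dual N i) * v j)
    (represents_munit i (dual N i) hj (dualI hj))).
move=> X f e a b ha hb; rewrite (r _ f) // /cup /cap /pairing.
transitivity (\sum_(1 <= i < N.+1) (a == i)%:R *
  ((b == dual N i)%:R * u (dual N i) * \sum_(1 <= j < N.+1) v j * f j (dual N j))).
  apply: eq_bigr => i _; rewrite !mulr_sumr; apply: eq_bigr => j _; ring.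
rewrite sum_pick // mul1r; congr (_ * _).
by case: eqP => [->|]; rewrite ?mul0r.
Qed.

Hypotheses (gSL : g <> SL) (q0 : q != 0).
Variables (l c p mu : K).
Hypotheses (hB : braid_inv N q u v h 0 l) (hC : cup_inv N q u v h al be sg 0 l mu c).
Hypotheses (hA : act_quadratic N al be sg 0 c p) (hl : mu * p = l).
Hypothesis (hx : 1 + (q - q^-1) * l - l ^+ 2 != 0).
Hypothesis (el : triv_eigenvalue g N q = l).
Local Notation x := (cap0 cup0).
Local Notation S := (Smat g N q s).

Let capZ y f : cap0 (fun i j => y * f i j) = y * cap0 f.
Proof. by rewrite /cap /pairing mulr_sumr; apply: eq_bigr => i _; ring. Qed.

Let braidZr y f a b : inside N 0 a -> inside N 0 b ->
  braid0 (fun i j => f i j * y) a b = braid0 f a b * y.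
Proof.
move=> ha hb; rewrite /braid.
have -> : pairing N v 0 b (fun i j => f i j * y) = pairing N v 0 b f * y.
  by rewrite /pairing mulr_suml; apply: eq_bigr => i _; ring.
ring.
Qed.

Lemma cupcap_braid : cupcap *m S = l *: cupcap.
Proof.
apply: (represents_inj (represents_mul represents_cupcap represents_Smat)
  (represents_scale l represents_cupcap)) => f a b ha hb.
by rewrite (cap_braid hB); ring.
Qed.

Lemma braid_cupcap : S *m cupcap = l *: cupcap.
Proof.
apply: (represents_inj (represents_mul represents_Smat represents_cupcap)
  (represents_scale l represents_cupcap)) => f a b ha hb.
by rewrite braidZr // (braid_cup hB) //; ring.
Qed.

Lemma braid_sqr :
  S *m S = 1%:M + (q - q^-1) *: S - ((q - q^-1) * l) *: cupcap.
Proof.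
have r1 : represents 1%:M id by move=> X f e a b ha hb; rewrite mul1mx e.
apply: (represents_inj (represents_mul represents_Smat represents_Smat)
  (represents_sub (represents_add r1 (represents_scale _ represents_Smat))
    (represents_scale _ represents_cupcap))) => f a b ha hb.
by rewrite (braidK hB) //; ring.
Qed.

Lemma varpiE : varpi g N q s = x^-1 *: cupcap.
Proof.
have dlx := cap_cup hB; set d := q - q^-1 in dlx *.
have dlx0 : d * l * x != 0 by rewrite dlx.
have x0 : x != 0 by apply: contra_neq dlx0 => ->; rewrite mulr0.
(* By the skein relation the left side is (1 + d l - l^2) - d l cup cap, and [cap_cup] rewrites the
   scalar as d l x. Hence 1 - cup cap / x is a multiple of S - l on either side. *)
have prodE : (S + (l - d)%:M) *m (S - l%:M)
    = (d * l * x) *: (1%:M - x^-1 *: cupcap).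
  rewrite mulmxDl !mulmxBr braid_sqr mul_mx_scalar !mul_scalar_mx.
  rewrite scalerBr scalerA mulfK // dlx -/d; set C := cupcap; set T := S.
  by apply/matrixP => i j; rewrite !mxE; ring.
have comm : (S - l%:M) *m (S + (l - d)%:M) = (S + (l - d)%:M) *m (S - l%:M).
  rewrite !(mulmxBl, mulmxBr, mulmxDl, mulmxDr) !mul_mx_scalar !mul_scalar_mx.
  set SS := S *m S; set T := S.
  by apply/matrixP => i j; rewrite !mxE; ring.
have hK : (S - l%:M) *m cupcap = 0.
  by rewrite mulmxBl braid_cupcap mul_scalar_mx subrr.
have hK' : cupcap *m (S - l%:M) = 0.
  by rewrite mulmxBr cupcap_braid mul_mx_scalar subrr.
rewrite /varpi el; apply: (@spectral_projectorE _ _ _ _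
    ((d * l * x)^-1 *: (S + (l - d)%:M))).
- by rewrite -scalemxAl hK' scaler0.
- by rewrite -scalemxAr hK scaler0.
- by rewrite -scalemxAl prodE scalerA mulVf // scale1r.
- by rewrite -scalemxAr comm prodE scalerA mulVf // scale1r.
Qed.

Let act_cup_act a b : inside N 0 a -> inside N 0 b ->
  act (braid0 (act cup0)) a b = l * cup0 a b.
Proof.
move=> ha hb; have [hb' _ _ _] := hA hb.
transitivity (act (fun i j => 0 * cup0 i j
  - (- mu) * (fun i j => act cup0 i j - c * cup0 i j) i j) a b).
  apply: (act2_ext _ _ hb hb') => j hj.
  by rewrite (braid_act_cup hC) //; ring.
rewrite (act2_sub al be sg (fun i j => 0 * cup0 i j)) act2_sub (act2K _ _ hA) // -hl.
rewrite /act2; ring.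
Qed.

Let cap_act_act f : cap0 (act (braid0 (act f))) = l * cap0 f.
Proof.
rewrite (cap_act_braid hC) -cap_sub -capZ -capZ; apply: cap_ext => i j hi hj.
by rewrite (act2K _ _ hA) // -hl; ring.
Qed.

Lemma invariant_form_equation_point : invariant_form_equation g q s A.
Proof.
have [[rA rS] rC] := ((represents_snd, represents_Smat), represents_cupcap).
have actZr y f a b : act (fun i j => f i j * y) a b = act f a b * y.
  by rewrite /act2; ring.
rewrite /invariant_form_equation varpiE el.
have e1 : snd_leg A *m S *m snd_leg A *m cupcap = l *: cupcap.
  apply: (represents_inj (represents_mul (represents_mul (represents_mul rA rS)
    rA) rC) (represents_scale l rC)) => f a b ha hb.
  have [hb' _ _ _] := hA hb.
  rewrite mulrA -act_cup_act // -actZr; apply: (act2_ext _ _ hb hb') => j hj.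
  by rewrite -braidZr //; apply: braid_ext => // i k _ _; rewrite actZr.
have e2 : cupcap *m snd_leg A *m S *m snd_leg A = l *: cupcap.
  apply: (represents_inj (represents_mul (represents_mul (represents_mul rC rA)
    rS) rA) (represents_scale l rC)) => f a b ha hb.
  by rewrite cap_act_act; ring.
split; first by rewrite -scalemxAr e1 !scalerA mulrC.
by rewrite -!scalemxAl e2 !scalerA mulrC.
Qed.

End Point.
End Operators.
End Matrices.

(** * Entries of the matrices of the theorem *)

Section Entries.
Variables (K : numFieldType) (n : nat) (q : K).
Local Notation N := n.+1.
Local Notation D := (dual N).

Definition outer_coef m : K := q ^ (- m%:Z) * (1 - q ^ (- N%:Z + (2 * m)%:Z)).

Definition diag_coef m i : K :=
  if (i <= m)%N then outer_coef m else if (i < D m)%N then q ^ (- m%:Z) else 0.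

Let sum_munit (P : pred nat) (x : nat -> K) (t : nat -> nat) (i j : 'I_N) :
  (\sum_(1 <= k < N.+1 | P k) x k *: munit K N k (t k)) i j
  = (P i.+1)%:R * ((j.+1 == t i.+1)%:R * x i.+1).
Proof.
have hi : inside N 0 i.+1 by have := ltn_ord i; nlia.
rewrite summxE -(sum_pick P (fun k => (j.+1 == t k)%:R * x k) hi).
by apply: eq_bigr => k _; rewrite !mxE -mulnb natrM mulrC -!mulrA.
Qed.

Lemma diag_partE m (i j : 'I_N) : (2 * m <= N)%N ->
  diag_part N m q i j = (j.+1 == i.+1)%:R * diag_coef m i.+1.
Proof.
move=> hm; rewrite /diag_part.
rewrite (@big_nat_widen _ _ _ 1 m.+1 N.+1) //=; last by lia.
rewrite mxE (sum_munit (fun k => k < m.+1)%N (fun _ => outer_coef m) id).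
rewrite (sum_munit (fun k => m < k < D m)%N (fun _ => q ^ (- m%:Z)) id) /diag_coef.
rewrite ltnS [(m < i.+1)%N]ltnNge.
case: (i.+1 <= m)%N => /=; first by rewrite mul1r mul0r addr0.
by rewrite mul0r add0r; case: ifP => _; rewrite ?mul1r // mul0r mulr0.
Qed.

Lemma diag_part0E m (i j : 'I_N) :
  diag_part0 K N m i j = (j.+1 == i.+1)%:R * (m < i.+1 < D m)%N%:R.
Proof.
rewrite /diag_part0; under eq_bigr do rewrite -[munit _ _ _ _]scale1r.
by rewrite (sum_munit (fun k => m < k < D m)%N (fun _ => 1) id) mulr1 mulrC.
Qed.

Lemma anti_partE (I : pred nat) (y : nat -> K) (i j : 'I_N) :
  anti_part N I y i j = (j.+1 == D i.+1)%:R * ((I i.+1)%:R * y i.+1).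
Proof. by rewrite /anti_part (sum_munit I y D) mulrCA. Qed.

(** An even i = j + 1 is the second row of the block of the odd index j, whose entry stands in
    column j' = i' + 1. *)
Definition skew_dual i := if odd i then (D i).-1 else (D i).+1.

Definition skew_coef (I : pred nat) (z : nat -> K) i : K :=
  if odd i then (I i)%:R * z i else - ((I i.-1)%:R * z i.-1).

Lemma skew_partE (I : pred nat) (z : nat -> K) (i j : 'I_N) : ~~ odd N ->
  (forall k, I k -> (1 <= k < N)%N && odd k) ->
  skew_part N I z i j = (j.+1 == skew_dual i.+1)%:R * skew_coef I z i.+1.
Proof.
move=> hN hI; rewrite /skew_part.
have -> : \sum_(1 <= k < N.+1 | I k)
    z k *: (munit K N k (D k).-1 - munit K N k.+1 (D k))
  = \sum_(1 <= k < N.+1 | I k) z k *: munit K N k (D k).-1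
    - \sum_(1 <= k < N.+1 | I k) z k *: munit K N k.+1 (D k).
  by rewrite -sumrB; apply: eq_bigr => k _; rewrite scalerBr.
rewrite mxE (sum_munit I z (fun k => (D k).-1)).
(* The summation index becomes the row, as [sum_munit] requires; the shift loses nothing because N
   is not in I. *)
have -> : \sum_(1 <= k < N.+1 | I k) z k *: munit K N k.+1 (D k)
    = \sum_(1 <= k < N.+1 | (1 < k)%N && I k.-1) z k.-1 *: munit K N k (D k.-1).
  rewrite big_mkcond [RHS]big_mkcond /=.
  rewrite big_nat_recr //= [RHS]big_ltn // /= add0r.
  rewrite (_ : I N = false); last by apply/negP => /hI; lia.
  rewrite addr0 [RHS]big_add1 /=; apply: eq_big_nat => k hk.
  by rewrite (_ : (1 < k.+1)%N = true) //; lia.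
rewrite mxE (sum_munit (fun k => (1 < k)%N && I k.-1) (fun k => z k.-1)
  (fun k => D k.-1)).
rewrite /skew_dual /skew_coef /=.
have ltN := ltn_ord i.
case: ifP => oi.
  rewrite [X in _ - X](_ : _ = 0) ?subr0; first by rewrite mulrCA.
  rewrite (_ : I i = false) ?andbF ?mul0r //; apply/negP => /hI; lia.
rewrite (_ : I i.+1 = false) ?mul0r ?add0r; last by apply/negP => /hI; rewrite /=; lia.
rewrite (_ : D i = (D i.+1).+1); last by nlia.
case: (posnP i) => [i0|ipos]; first by rewrite i0 in oi.
by rewrite ltnS ipos /= mulrN mulrCA.
Qed.

End Entries.

(** * The four families *)

Section Cases.
Variables (K : numFieldType) (n : nat) (g : lie_type) (q s : K).
Local Notation N := n.+1.
Local Notation D := (dual N).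
Hypotheses (hq : generic q) (hs : s ^+ 2 = q).
Local Notation d := (q - q^-1).
Local Notation u := (weight n g s).
Local Notation v := (coweight n g s).
Local Notation h := (exchange n g q).
Local Notation outer_coef := (outer_coef n q).
Local Notation diag_coef := (diag_coef n q).
Local Notation skew_dual := (skew_dual n).

Let q0 : q != 0. Proof. by case: hq. Qed.

Lemma generic_expr_neq1 k : (0 < k)%N -> q ^+ k != 1.
Proof. by case: hq => _ /(_ k) H /H; rewrite unity_rootE. Qed.

Let s0 : s != 0.
Proof. by apply: contra_neq q0 => e; rewrite -hs e expr0n. Qed.

Let d0 : d != 0.
Proof.
apply: contraNneq (generic_expr_neq1 (isT : 0 < 2)%N) => /eqP.
by rewrite subr_eq0 => /eqP e; rewrite expr2 {1}e mulVf.
Qed.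

Let qexp (z : int) : q ^ z = s ^ (2 * z).
Proof. by rewrite -exprz_exp -hs. Qed.

(* The eigenvalue of S on [cup] when S is truncated to k < i < k'. *)
Definition scale_factor k : K :=
  (eps g)%:~R * q ^ (- N%:Z + (2 * k)%:Z + eps g).
Local Notation lam := scale_factor.

Let eps_sqr : (eps g)%:~R ^+ 2 = 1 :> K.
Proof. by case: g; rewrite ?expr1n // sqrrN expr1n. Qed.

Lemma scale_factor0 : triv_eigenvalue g N q = lam 0.
Proof. by rewrite /triv_eigenvalue /scale_factor addr0. Qed.

Let lam0 k : lam k != 0.
Proof.
rewrite mulf_neq0 ?expfz_neq0 // -sqrf_eq0; by rewrite eps_sqr oner_eq0.
Qed.

Let lamS k : lam k.+1 = q ^+ 2 * lam k.
Proof.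
rewrite /scale_factor mulrCA; congr (_ * _).
rewrite (_ : _ + _ + _ = 2 + (- N%:Z + (2 * k)%:Z + eps g)); last by lia.
by rewrite expfzDr.
Qed.

Lemma generic_exprz_neq1 (z : int) : z != 0 -> q ^ z != 1.
Proof.
case: z => k hk; first by apply: generic_expr_neq1; lia.
by rewrite [q ^ _](_ : _ = (q ^+ k.+1)^-1) // invr_eq1 generic_expr_neq1.
Qed.

Let exprz_neqN1 (z : int) : z != 0 -> q ^ z != - 1.
Proof.
move=> hz; apply: contra_neq (_ : q ^ (z * 2) != 1) => [e|].
  by rewrite -exprz_exp e -exprnP sqrrN expr1n.
by apply: generic_exprz_neq1; lia.
Qed.

(** This number is d l cap (cup), so it makes the normalization of the spectral projector possible.
    It vanishes only if l is q or -1/q, that is if q^N = 1, or q^(N-2) = -1 for so(N), or q^(N+2) =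
    -1 for sp(N). *)
Lemma generic_nondegenerate : g <> SL -> admissible g N ->
  1 + d * lam 0 - lam 0 ^+ 2 != 0.
Proof.
move=> gSL hN.
have -> : 1 + d * lam 0 - lam 0 ^+ 2 = - ((lam 0 - q) * (lam 0 + q^-1)).
  by field.
have key (z t : int) (x : K) : q ^ z = x * q ^ t -> q ^ (z - t) = x.
  by move=> e; rewrite expfzDr // e -mulrA -expfzDr // subrr mulr1.
rewrite oppr_eq0 mulf_neq0 // ?subr_eq0 ?addr_eq0 /scale_factor.
- case: g gSL hN => // _ hN; apply/negP => /eqP; rewrite /= ?mul1r ?mulN1r => e.
  + by have /eqP := key _ 1 1 (etrans e (esym (mul1r _)));
      apply/negP; apply: generic_exprz_neq1; lia.
  + have /eqP := key _ 1 (-1) (etrans (esym (opprK _))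
      (etrans (congr1 -%R e) (esym (mulN1r _)))).
    by apply/negP; apply: exprz_neqN1; lia.
- case: g gSL hN => // _ hN; apply/negP => /eqP; rewrite /= ?mul1r ?mulN1r => e.
  + have /eqP := key _ (-1) (-1) (etrans e (esym (mulN1r _))).
    by apply/negP; apply: exprz_neqN1; move: hN; rewrite /admissible; lia.
  + have /eqP := key _ (-1) 1 (etrans (oppr_inj e) (esym (mul1r _))).
    by apply/negP; apply: generic_exprz_neq1; lia.
Qed.

Section Weights.
Hypothesis gSL : g <> SL.

Let weightE k : u k = (kappa g N k)%:~R * s ^ rho2 g N k.
Proof. by rewrite /weight; case: g gSL. Qed.

Lemma coweightE k : v k = (u k)^-1.
Proof.
rewrite weightE invfM invr_expz /coweight /kappa.
by case: g gSL => // _; try case: ifP => _; rewrite ?invr1 ?invrN1.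
Qed.

Let weight0 k : u k != 0.
Proof.
rewrite weightE mulf_neq0 ?expfz_neq0 // /kappa.
by case: g; try case: ifP => _; rewrite ?oner_eq0 // oppr_eq0 oner_eq0.
Qed.

Let weight_upper k : (2 * k.+1 <= N)%N -> u k.+1 = s ^ rho2_upper g N k.+1.
Proof.
move=> hk; rewrite weightE /kappa /rho2 hk; decide_nat.
by case: g; rewrite mul1r.
Qed.

Lemma weights_dual : dual_weights N q u v lam.
Proof.
move=> k hk; rewrite !coweightE weight0; split=> //.
rewrite weight_upper; last by lia.
have rho2' : rho2 g N (D k.+1) = - rho2_upper g N k.+1.
  rewrite /rho2 (_ : D (D k.+1) = k.+1); last by nlia.
  by decide_nat; rewrite ifF //; nlia.
have kappa' : kappa g N (D k.+1) = eps g.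
  by rewrite /kappa /eps; case: g => //; rewrite ifF //; nlia.
rewrite weightE rho2' kappa' /scale_factor mulrCA -mulrA; congr (_ * _).
rewrite -[in X in _ = X * _](expr1z q) -!(expfzDr _ _ q0) qexp -expfzDr //; congr (_ ^ _).
by rewrite /rho2_upper /eps; case: g gSL => // _; lia.
Qed.

Lemma weights_step k : (k.+2 < N - k.+1)%N -> u k.+2 = q^-1 * u k.+1.
Proof.
move=> hk; rewrite !weight_upper; try by lia.
have -> : rho2_upper g N k.+2 = 2 * (-1) + rho2_upper g N k.+1.
  by rewrite /rho2_upper; case: g; lia.
by rewrite expfzDr // -qexp.
Qed.

Lemma exchange_offdiag a b : inside N 0 a -> inside N 0 b ->
  ~~ ((a == b) && (a == D a)) ->
  h a b = if a == b then q else if a == D b then q^-1 else 1.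
Proof.
move=> ha hb hab; have -> : h a b = q ^ ((b == a)%:Z - (b == D a)%:Z).
  by rewrite /exchange; case: g gSL.
have [e|/eqP e] := eqVneq a b; first by rewrite (_ : (b == D a) = false) //; nlia.
by rewrite (_ : (b == D a) = (a == D b)); [case: ifP | nlia].
Qed.

Lemma braid_inv_generic k : admissible g N -> (2 * k <= N)%N ->
  braid_inv N q u v h k (lam k).
Proof.
move=> hN; move: k.
have hall := (braid_inv_all q0 d0 lam0 lamS weights_dual exchange_offdiag).
apply: hall => k h1 h2.
have [e|e] := leqP N (2 * k).
  apply: braid_inv_empty; first by nlia.
  rewrite /scale_factor (_ : - N%:Z + (2 * k)%:Z = 0) ?add0r; last by lia.
  by case: g gSL => // _; rewrite /eps ?expr1z ?exprN1; field.
have gSO : g = SO by case: g gSL hN => // _; rewrite /admissible; lia.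
have eN : N = (2 * k).+1 by lia.
have eD : D k.+1 = k.+1 by nlia.
have hu : u k.+1 = 1 by rewrite weightE gSO /rho2 eD eqxx mul1r.
have -> : lam k = 1 by rewrite /scale_factor gSO mul1r (_ : _ + _ = 0) //=; lia.
apply: braid_inv_single => //; first by nlia.
- by rewrite /exchange gSO eD eqxx subrr.
- by rewrite coweightE hu invr1.
Qed.

End Weights.

Lemma quantum_point (A : 'M[K]_N) (al be : nat -> K) (sg : nat -> nat) c p mu :
  g <> SL -> admissible g N ->
  (forall i j : 'I_N, A i j
     = (j.+1 == i.+1)%:R * al i.+1 + (j.+1 == sg i.+1)%:R * be i.+1) ->
  act_quadratic N al be sg 0 c p -> mu * p = lam 0 ->
  cup_inv N q u v h al be sg 0 (lam 0) mu c /\ reflection N q u v h al be sg 0 ->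
  reflection_equation g q s A /\ invariant_form_equation g q s A.
Proof.
move=> gSL hN hA hquad hmu [hC hr].
have sgI i : inside N 0 i -> inside N 0 (sg i) by case/hquad.
split; first exact: (reflection_equation_point s0 hA sgI hr).
exact: (invariant_form_equation_point s0 hA sgI
  (braid_inv_generic gSL hN (isT : (2 * 0 <= N)%N)) hC hquad hmu
  (generic_nondegenerate gSL hN) scale_factor0).
Qed.

(** The scalar middle q^-m is a root of x^2 = c x + q^-N, the quadratic equation of the outer
    blocks. *)
Let outer_scalar m :
  (q ^ (- m%:Z)) ^+ 2 = outer_coef m * q ^ (- m%:Z) + q ^ (- N%:Z).
Proof.
have -> : q ^ (- N%:Z)
    = q ^ (- m%:Z) * q ^ (- m%:Z) * q ^ (- N%:Z + (2 * m)%:Z).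
  by rewrite -!(expfzDr _ _ q0); congr (_ ^ _); lia.
by rewrite /outer_coef; set x := q ^ (- m%:Z); set t := q ^ (_ + _); ring.
Qed.

(** For an outer b exactly one of b and [sg b] is at most m, so the two diagonal coefficients add up
    to c. The sign e changes c but not p. *)
Lemma act_quadratic_diag (e : K) m (be : nat -> K) (sg : nat -> nat) k :
  e ^+ 2 = 1 -> (2 * m <= N)%N ->
  (forall b, inside N k b -> inside N k (sg b) /\ sg (sg b) = b) ->
  (forall b, inside N k b -> (b <= m)%N -> (D m <= sg b)%N) ->
  (forall b, inside N k b -> (D m <= b)%N -> (sg b <= m)%N) ->
  (forall b, inside N k b -> (m < b < D m)%N -> be b = 0) ->
  (forall b, inside N k b -> ~~ (m < b < D m)%N ->
     be b * be (sg b) = q ^ (- N%:Z)) ->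
  act_quadratic N (fun i => e * diag_coef m i) be sg k
    (e * outer_coef m) (q ^ (- N%:Z)).
Proof.
move=> he hm hsg hlow hup hmid hbe b hb; have [sb ssb] := hsg b hb.
split=> //.
- rewrite /diag_coef /=; case: (leqP b m) => h1.
    by rewrite hbe //; try nlia; ring.
  case: (ltnP b (D m)) => h2.
    by rewrite hmid ?h1 // mul0r addr0 mulrACA exprMn -expr2 he !mul1r
      outer_scalar.
  by rewrite hbe ?expr2 ?mulr0 ?add0r //; lia.
- case: (boolP (m < b < D m)%N) => h1; first by rewrite hmid // !mul0r.
  congr (_ * _); rewrite /diag_coef /=; case: (leqP b m) => h2.
    by have := hlow b hb h2 => h3; rewrite !ifF; [ring | lia | nlia].
  have h4 : (sg b <= m)%N by apply: hup => //; lia.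
  by rewrite h4 ifF; [ring | lia].
Qed.

Let dual_inside k b : inside N k b -> inside N k (D b) /\ D (D b) = b.
Proof. by move=> hb; split; nlia. Qed.

Let dual_outer m : (2 * m <= N)%N ->
  [/\ forall k b, inside N k b -> (b <= m)%N -> (D m <= D b)%N,
      forall k b, inside N k b -> (D m <= b)%N -> (D b <= m)%N
    & forall k b, inside N k b -> outer N m b = ~~ (m < b < D m)%N].
Proof. by move=> hm; rewrite /outer; split=> k b hb; nlia. Qed.

Lemma diag_anti_point (e : K) m (y : nat -> K) : g <> SP -> admissible g N ->
  e ^+ 2 = 1 -> (2 * m <= N)%N ->
  (forall i, outer N m i -> y i * y (D i) = q ^ (- N%:Z)) ->
  let A := e *: (diag_part N m q + anti_part N (outer N m) y) in
  reflection_equation g q s A /\ (g <> SL -> invariant_form_equation g q s A).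
Proof.
move=> gSP hN he hm hy A.
pose be i : K := e * ((outer N m i)%:R * y i).
pose al i : K := e * diag_coef m i.
have entries (i j : 'I_N) :
    A i j = (j.+1 == i.+1)%:R * al i.+1 + (j.+1 == D i.+1)%:R * be i.+1.
  by rewrite /A mxE mxE diag_partE // anti_partE /al /be; ring.
have [d1 d2 d3] := dual_outer hm.
have hquad k : act_quadratic N al be D k (e * outer_coef m) (q ^ (- N%:Z)).
  apply: act_quadratic_diag => // [|||b hb hmb|b hb hmb].
  - exact: dual_inside.
  - exact: d1.
  - exact: d2.
  - by rewrite /be (d3 _ _ hb) hmb mul0r mulr0.
  - rewrite /be (d3 _ _ hb) hmb -(hy b) ?(d3 _ _ hb) //.
    have [hb' _] := dual_inside hb.
    rewrite (d3 _ _ hb') (_ : ~~ _) /=; last by nlia.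
    by rewrite !mul1r mulrACA -expr2 he mul1r.
have step k : (k < m)%N ->
  [/\ act_quadratic N al be D k.+1 (e * outer_coef m) (q ^ (- N%:Z)),
    al k.+1 = e * outer_coef m, al (D k.+1) = 0, be k.+1 * be (D k.+1) = q ^ (- N%:Z)
    & D k.+1 = D k.+1 /\ D (D k.+1) = k.+1].
  move=> hk; have hb : inside N 0 k.+1 by nlia.
  split; [exact: hquad | by rewrite /al /diag_coef hk | | | by split; nlia].
  - by rewrite /al /diag_coef !ifF ?mulr0 //; nlia.
  - rewrite /be !(d3 0); try by nlia.
    have -> : ~~ (m < k.+1 < D m)%N by lia.
    have -> : ~~ (m < D k.+1 < D m)%N by nlia.
    by rewrite !mul1r mulrACA -expr2 he mul1r hy // (d3 _ _ hb); lia.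
have hal i : inside N m i -> al i = e * q ^ (- m%:Z).
  by move=> hi; rewrite /al /diag_coef ifF ?ifT //; nlia.
have hbe i : inside N m i -> be i = 0.
  by move=> hi; rewrite /be (d3 _ _ hi) (_ : (m < i < D m)%N) ?mul0r ?mulr0.
have hbase := reflection_scalar q u v h D hal hbe.
have [gSL|gSL] : g = SL \/ g <> SL by case: (g); [left|right|right].
  split=> //; apply: (reflection_equation_point s0 entries).
    by move=> i /dual_inside[].
  apply: (reflection_descent_linear q0 d0 hm _ _ _ step hbase).
  - by move=> i; rewrite /weight gSL.
  - by move=> i; rewrite /coweight gSL.
  - by move=> a b; rewrite /exchange gSL.
have gSO : g = SO by case: g gSP gSL.
have hlam : lam 0 = q * q ^ (- N%:Z).
  rewrite /scale_factor gSO mul1r -{2}(expr1z q) -expfzDr //.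
  by congr (_ ^ _); rewrite /eps; lia.
have [] := quantum_point gSL hN entries (hquad 0%N) (esym hlam); last by [].
apply: (reflection_descent1 q0 d0 lam0 lamS (weights_dual gSL)
  (exchange_offdiag gSL) hm step _ hbase).
apply: (cup_inv_scalar D hal hbe (braid_inv_generic gSL hN hm) _ q0); last by field.
rewrite -mulrBr mulrCA [RHS]mulrCA; congr (_ * _).
have -> : q ^ (- m%:Z) - outer_coef m = q ^ (- m%:Z) * q ^ (- N%:Z + (2 * m)%:Z).
  by rewrite /outer_coef mulrBr mulr1 subKr.
rewrite /scale_factor gSO mul1r -{3}(expr1z q) -!(expfzDr _ _ q0); congr (_ ^ _).
by rewrite /eps; lia.
Qed.

Lemma anti_point (y : nat -> K) : g = SP -> admissible g N ->
  (forall i, inside N 0 i -> y i * y (D i) = - q ^ (- N%:Z - 2)) ->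
  let A := anti_part N (fun i => 1 <= i <= N)%N y in
  reflection_equation g q s A /\ invariant_form_equation g q s A.
Proof.
move=> gSP hN hy A; have gSL : g <> SL by rewrite gSP.
have Neven : ~~ odd N by move: hN; rewrite gSP => /andP[].
pose p := - q ^ (- N%:Z - 2).
have inE i : inside N 0 i = (1 <= i <= N)%N by nlia.
pose al i : K := 0 * i%:R; pose be i : K := (1 <= i <= N)%N%:R * y i.
have al0 i : al i = 0 by rewrite /al mul0r.
have be_mul i : inside N 0 i -> be i * be (D i) = p.
  move=> hi; have [hi' _] := dual_inside hi.
  by rewrite /be -!inE hi hi' !mul1r hy.
have entries (i j : 'I_N) :
    A i j = (j.+1 == i.+1)%:R * al i.+1 + (j.+1 == D i.+1)%:R * be i.+1.
  by rewrite anti_partE al0 mulr0 add0r.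
have hquad k : act_quadratic N al be D k 0 p.
  move=> b hb; have [hb' hbb] := dual_inside hb.
  split=> //; rewrite !al0; last by rewrite subr0 !mulr0.
  by rewrite be_mul ?expr0n ?mul0r //; nlia.
have hlam : q * p = lam 0.
  rewrite /scale_factor gSP mulrN mulN1r -{1}(expr1z q) -expfzDr //.
  by congr (- (_ ^ _)); rewrite /eps; lia.
apply: (quantum_point gSL hN entries (hquad 0%N) hlam).
(* All pairs are outer: the induction starts from an empty middle at k = N/2. *)
have hm : (2 * N./2 <= N)%N by lia.
have hempty : (D N./2 <= N./2.+1)%N by nlia.
apply: (reflection_descent1 q0 d0 lam0 lamS (weights_dual gSL)
  (exchange_offdiag gSL) hm) => [k hk||].
- split; [exact: hquad | exact: al0 | exact: al0 | apply: be_mul; nlia |].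
  by split; nlia.
- exact: cup_inv_empty.
- exact: reflection_empty.
Qed.

Lemma skew_dual_inside k b : ~~ odd N -> ~~ odd k -> inside N k b ->
  inside N k (skew_dual b) /\ skew_dual (skew_dual b) = b.
Proof.
rewrite /skew_dual => hN hk hb.
by case: ifP => ob; [rewrite ifT | rewrite ifF]; first split; nlia.
Qed.

Lemma skew_coef_mul (I : pred nat) (z : nat -> K) p b : ~~ odd N ->
  (forall i, I i -> [/\ odd i, (0 < i < N)%N, I (D i).-1
     & z i * z (D i).-1 = p]) ->
  inside N 0 b -> I (if odd b then b else b.-1) ->
  skew_coef I z b * skew_coef I z (skew_dual b) = p.
Proof.
move=> hN hI hb; rewrite /skew_coef /skew_dual; case: ifP => ob Ib.
  have [_ lt Ib' <-] := hI _ Ib.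
  by rewrite ifT ?Ib ?Ib' ?mul1r //; nlia.
have [_ lt Ib' <-] := hI _ Ib.
rewrite ifF; last by nlia.
have -> : (D b).+1.-1 = (D b.-1).-1 by nlia.
by rewrite Ib Ib' !mul1r mulrNN.
Qed.

Let skew_peel (al : nat -> K) (c p e : K) (I : pred nat) (z : nat -> K) m :
  e ^+ 2 = 1 ->
  ~~ odd N -> (4 * m <= N)%N ->
  (forall i, I i -> [/\ odd i, (0 < i < N)%N, I (D i).-1
     & z i * z (D i).-1 = p]) ->
  (forall j, (j < m)%N -> I (2 * j).+1) ->
  (forall k, ~~ odd k ->
     act_quadratic N al (fun i => e * skew_coef I z i) skew_dual k c p) ->
  (forall i, (0 < i <= 2 * m)%N -> al i = c /\ al (D i) = 0) ->
  forall j, (j < m)%N -> let k := (2 * j)%N in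
  [/\ act_quadratic N al (fun i => e * skew_coef I z i) skew_dual k.+2 c p,
      [/\ al k.+1 = c, al k.+2 = c, al (D k.+1) = 0 & al (D k.+2) = 0],
      [/\ skew_dual k.+1 = D k.+2, skew_dual k.+2 = D k.+1,
          skew_dual (D k.+1) = k.+2 & skew_dual (D k.+2) = k.+1],
      e * skew_coef I z k.+2 = - (e * skew_coef I z k.+1)
      /\ e * skew_coef I z (D k.+1) = - (e * skew_coef I z (D k.+2))
    & e * skew_coef I z k.+1 * (e * skew_coef I z (D k.+2)) = p].
Proof.
move=> he hN hm hI hIk hquad hal j hj k.
have [a1 a1'] : al k.+1 = c /\ al (D k.+1) = 0 by apply: hal; lia.
have [a2 a2'] : al k.+2 = c /\ al (D k.+2) = 0 by apply: hal; lia.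
have ok : odd k.+1 by rewrite /k; lia.
have sd : skew_dual k.+1 = D k.+2 by rewrite /skew_dual ok; nlia.
split=> //.
- by apply: hquad; rewrite /k; lia.
- by rewrite sd /skew_dual; split=> //; [rewrite ifF | rewrite ifF | rewrite ifT]; nlia.
- rewrite -!mulrN /skew_coef ok ifF; last by nlia.
  split=> //; congr (_ * _); rewrite ifF ?ifT; try by nlia.
  by have -> : (D k.+1).-1 = D k.+2 by nlia.
- rewrite -sd mulrACA -expr2 he mul1r (skew_coef_mul (p := p)) //; first by nlia.
  by rewrite ok; apply: hIk.
Qed.

Lemma diag_skew_point (e : K) m (z : nat -> K) : g = SP -> admissible g N ->
  e ^+ 2 = 1 -> ~~ odd m -> (2 * m <= N)%N ->
  let I := fun i => outer N m i && odd i in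
  (forall i, I i -> z i * z (D i).-1 = q ^ (- N%:Z)) ->
  let A := e *: (diag_part N m q + skew_part N I z) in
  reflection_equation g q s A /\ invariant_form_equation g q s A.
Proof.
move=> gSP hN he om hm I hz A; have gSL : g <> SL by rewrite gSP.
have Neven : ~~ odd N by move: hN; rewrite gSP => /andP[].
have hI i : I i -> [/\ odd i, (0 < i < N)%N, I (D i).-1
     & z i * z (D i).-1 = q ^ (- N%:Z)].
  move=> Ii; rewrite hz //; move: Ii; rewrite /I /outer => /andP[h1 h2].
  by split=> //; nlia.
pose al i : K := e * diag_coef m i; pose be i : K := e * skew_coef I z i.
have entries (i j : 'I_N) :
    A i j = (j.+1 == i.+1)%:R * al i.+1 + (j.+1 == skew_dual i.+1)%:R * be i.+1.
  rewrite /A mxE mxE diag_partE // skew_partE // /al /be; first by ring.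
  by move=> k /hI[-> /andP[-> ->]].
have coef0 b : inside N 0 b -> (m < b < D m)%N -> skew_coef I z b = 0.
  move=> hb hmb; rewrite /skew_coef /I /outer; case: ifP => ob.
    by rewrite (_ : _ && _ = false) ?mul0r //; nlia.
  by rewrite (_ : _ && _ = false) ?mul0r ?oppr0 //; nlia.
have hquad k : ~~ odd k ->
    act_quadratic N al be skew_dual k (e * outer_coef m) (q ^ (- N%:Z)).
  move=> hk; apply: act_quadratic_diag => // [b|b|b|b hb hmb|b hb hmb].
  - exact: skew_dual_inside.
  - by rewrite /skew_dual => hb hbm; case: ifP => ob; nlia.
  - by rewrite /skew_dual => hb hbm; case: ifP => ob; nlia.
  - by rewrite /be coef0 ?mulr0 //; nlia.
  - rewrite /be mulrACA -expr2 he mul1r (skew_coef_mul (p := q ^ (- N%:Z))) //.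
      by nlia.
    by rewrite /I /outer; case: ifP => ob; nlia.
have hal i : inside N m i -> al i = e * q ^ (- m%:Z).
  by move=> hi; rewrite /al /diag_coef ifF ?ifT //; nlia.
have hbe i : inside N m i -> be i = 0.
  by move=> hi; rewrite /be coef0 ?mulr0 //; nlia.
have em : m = (2 * m./2)%N by lia.
have hlam : - q^-1 * q ^ (- N%:Z) = lam 0.
  rewrite /scale_factor gSP mulN1r mulNr -[q^-1]exprN1 -expfzDr //.
  by congr (- (_ ^ _)); rewrite /eps; lia.
apply: (quantum_point gSL hN entries (hquad 0%N isT) hlam).
apply: (reflection_descent2 q0 d0 lam0 lamS (weights_dual gSL)
  (exchange_offdiag gSL) (m := m./2) (c := e * outer_coef m) (p := q ^ (- N%:Z))).
- by lia.
- exact: weights_step.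
- apply: skew_peel => // [|j hj|i hi]; first by lia.
    by rewrite /I /outer; nlia.
  by rewrite /al /diag_coef; split; [rewrite ifT // | rewrite !ifF ?mulr0 //]; nlia.
- rewrite -em; apply: (cup_inv_scalar _ hal hbe (braid_inv_generic gSL hN hm)).
  + rewrite -mulrBr mulrCA [RHS]mulrCA; congr (_ * _).
    have -> : q ^ (- m%:Z) - outer_coef m = q ^ (- m%:Z) * q ^ (- N%:Z + (2 * m)%:Z).
      by rewrite /outer_coef mulrBr mulr1 subKr.
    rewrite /scale_factor gSP mulN1r !mulNr -[q^-1]exprN1 -!(expfzDr _ _ q0).
    by congr (- (_ ^ _)); rewrite /eps; lia.
  + by rewrite oppr_eq0 invr_eq0.
  + by field.
- by rewrite -em; apply: (reflection_scalar q u v h _ hal hbe).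
Qed.

Lemma skew_point (z : nat -> K) : g = SO -> admissible g N -> ~~ odd N ->
  let I := fun i => (1 <= i <= N.-1)%N && odd i in
  (forall i, I i -> z i * z (D i).-1 = - q ^ (- N%:Z + 2)) ->
  let A := skew_part N I z in
  reflection_equation g q s A /\ invariant_form_equation g q s A.
Proof.
move=> gSO hN Neven I hz A; have gSL : g <> SL by rewrite gSO.
pose p := - q ^ (- N%:Z + 2).
have hI i : I i -> [/\ odd i, (0 < i < N)%N, I (D i).-1 & z i * z (D i).-1 = p].
  move=> Ii; rewrite hz //; move: Ii; rewrite /I => /andP[h1 h2].
  by split=> //; nlia.
pose al i : K := 0 * i%:R; pose be i : K := 1 * skew_coef I z i.
have al0 i : al i = 0 by rewrite /al mul0r.
have entries (i j : 'I_N) :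
    A i j = (j.+1 == i.+1)%:R * al i.+1 + (j.+1 == skew_dual i.+1)%:R * be i.+1.
  rewrite skew_partE ?al0 ?mulr0 ?add0r /be ?mul1r // => k /hI[-> /andP[-> ->]] //.
have hquad k : ~~ odd k -> act_quadratic N al be skew_dual k 0 p.
  move=> hk b hb; have [hb' hbb] := skew_dual_inside Neven hk hb.
  split=> //; rewrite !al0; last by rewrite subr0 !mulr0.
  rewrite /be !mul1r (skew_coef_mul (p := p)) ?expr0n ?mul0r //; first by nlia.
  by rewrite /I; case: ifP => ob; nlia.
have hlam : - q^-1 * p = lam 0.
  rewrite /scale_factor gSO mul1r mulrNN -[q^-1]exprN1 -expfzDr //.
  by congr (_ ^ _); rewrite /eps; lia.
apply: (quantum_point gSL hN entries (hquad 0%N isT) hlam).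
(* If 4 divides N the middle is empty. Otherwise N = 2k + 2, and the two remaining indices are fixed
   by [skew_dual], so the skew matrix is diagonal there, with weights u = v = 1 because rho
   vanishes. *)
have base : let k := (2 * N./2./2)%N in
    cup_inv N q u v h al be skew_dual k (lam k) (- q^-1) 0
    /\ reflection N q u v h al be skew_dual k.
  have [e|e] := leqP N (2 * (2 * N./2./2)).
    by split; [apply: cup_inv_empty | apply: reflection_empty]; nlia.
  set k := (2 * N./2./2)%N in e *; have ek : N = (2 * k + 2)%N by lia.
  have ok : odd k.+1 by rewrite /k; lia.
  have s1 : skew_dual k.+1 = k.+1 by rewrite /skew_dual ok; nlia.
  have s2 : skew_dual k.+2 = k.+2 by rewrite /skew_dual ifF; nlia.
  have b2 : be k.+2 = - be k.+1.
    by rewrite /be !mul1r /skew_coef ok ifF //; nlia.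
  have hD : D k = k.+3 by nlia.
  have u1 : u k.+1 = 1.
    rewrite /weight gSO /kappa mul1r /rho2 ifF; last by nlia.
    by rewrite ifT /rho2_upper; [rewrite (_ : _ - _ = 0) //; lia | lia].
  have [_ v1 u2 v2] := weights_dual gSL (ltac:(lia) : (k.+1 < N - k)%N).
  have eD : D k.+1 = k.+2 by nlia.
  have lq : q * lam k = 1.
    by rewrite /scale_factor gSO mul1r -{1}(expr1z q) -expfzDr // (_ : _ + _ = 0) //= ; lia.
  rewrite eD lq mul1r u1 in u2; rewrite eD u2 invr1 in v2; rewrite u1 invr1 in v1.
  split.
    exact: (cup_inv_pair q0 d0 (exchange_offdiag gSL) hD (al0 _) (al0 _) s1 s2 b2
      u1 u2 v1 v2).
  exact: (reflection_pair (exchange_offdiag gSL) hD (al0 _) (al0 _) s1 s2 b2 u2 v1).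
have [base1 base2] := base.
apply: (reflection_descent2 q0 d0 lam0 lamS (weights_dual gSL)
  (exchange_offdiag gSL) _ _ _ base1 base2).
- by lia.
- exact: weights_step.
- have h4 : (4 * N./2./2 <= N)%N by lia.
  apply: (skew_peel (expr1n _ 2) Neven h4 hI _ hquad) => [j hj|i _].
    by rewrite /I; lia.
  by rewrite !al0.
Qed.

End Cases.

(** * The limit q -> 1 *)

Section Limits.
Variable K : numFieldType.
Local Notation at_one := (@at_one K).

#[local] Instance at_one_filter : Filter at_one.
Proof. exact: within_filter. Qed.

#[local] Instance at_one_proper : ProperFilter at_one.
Proof.
apply: Build_ProperFilter_ex => A [/= e e0 hA].
have e2 : 0 < e / 2 by rewrite divr_gt0 ?ltr0n.
(* An element greater than 1 has all its positive powers greater than 1, so it is no root of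
   unity. *)
exists (1 + e / 2); apply: hA => /=.
  rewrite opprD addrA subrr add0r normrN gtr0_norm //.
  by rewrite ltr_pdivrMr ?ltr0n // ltr_pMr // ltr1n.
split=> [|n n0]; first by rewrite gt_eqF // addr_gt0.
by rewrite unity_rootE gt_eqF // exprn_egt1 ?ltrDl // -lt0n.
Qed.

Lemma at_one_id : q @[q --> at_one] --> (1 : K).
Proof. exact: cvg_within. Qed.

Lemma exprz_at_one (z : int) : q ^ z @[q --> at_one] --> (1 : K).
Proof.
have pos k : q ^+ k @[q --> at_one] --> (1 : K).
  elim: k => [|k IH]; first exact: cvg_cst.
  under eq_fun do rewrite exprS.
  by have := cvgM at_one_id IH; rewrite mulr1; exact.
case: z => k; first exact: pos.
have := cvgV (oner_neq0 K) (pos k.+1); rewrite invr1; exact.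
Qed.

Lemma at_one_lim (f f' : K -> K) (a b : K) :
  (forall q, generic q -> f q = f' q) ->
  f q @[q --> at_one] --> a -> f' q @[q --> at_one] --> b -> a = b.
Proof.
move=> e fa fb; have fa' : f' q @[q --> at_one] --> a.
  have he : at_one [set q | f q = f' q]  :=
    @filterE _ (nbhs (1 : K)) (nbhs_filter (1 : K)) _ e.
  move=> B hB; have st q : f q = f' q -> B (f q) -> B (f' q) by move=> <-.
  exact: (@filterS2 _ at_one _ _ _ _ st he (fa B hB)).
exact: (cvg_unique (@norm_hausdorff _ K) fa' fb).
Qed.

Lemma cvg_entries m n (F : set_system K) (A : K -> 'M[K]_(m, n)) (A0 : 'M[K]_(m, n)) :
  Filter F ->
  (forall i j, A q i j @[q --> F] --> A0 i j) -> A q @[q --> F] --> A0.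
Proof.
move=> FF h B [P hP sPB]; rewrite nbhs_simpl /=.
have : \forall q \near F, forall i j, P i j (A q i j).
  apply: filter_forall => i; apply: filter_forall => j; exact: (h i j _ (hP i j)).
by apply: filterS => q hq; apply: sPB.
Qed.

Lemma cvg_scaled (e : K) (f : K -> K) (a : K) :
  f q @[q --> at_one] --> a -> e * f q @[q --> at_one] --> e * a.
Proof. by move=> fa; apply: cvgM => //; apply: cvg_cst. Qed.

Lemma cvg_bool (b : bool) (f : K -> K) (a : K) :
  (b -> f q @[q --> at_one] --> a) ->
  b%:R * f q @[q --> at_one] --> b%:R * a.
Proof.
case: b => h; first by apply: cvg_scaled; apply: h.
by rewrite mul0r; under eq_fun do rewrite mul0r; apply: cvg_cst.
Qed.

Lemma diag_coef_at_one n m i : diag_coef n q m i @[q --> at_one] -->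
  ((m < i < dual n.+1 m)%N%:R : K).
Proof.
rewrite /diag_coef /outer_coef [(m < i)%N]ltnNge; case: (i <= m)%N => /=.
  rewrite mulr0n -(mulr0 1) -(subrr 1).
  apply: cvgM; first exact: exprz_at_one.
  by apply: cvgB; [exact: cvg_cst | exact: exprz_at_one].
by case: (i < _)%N; [exact: exprz_at_one | exact: cvg_cst].
Qed.

Section Entrywise.
Variables (n m : nat) (I : pred nat) (y : nat -> K -> K) (y0 : nat -> K).
Local Notation N := n.+1.
Hypothesis hy : forall i, I i -> y i q @[q --> at_one] --> y0 i.

Lemma diag_part_at_one (i j : 'I_N) : (2 * m <= N)%N ->
  diag_part N m q i j @[q --> at_one] --> diag_part0 K N m i j.
Proof.
move=> hm; under eq_fun do rewrite diag_partE //.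
by rewrite diag_part0E; apply: cvg_bool => _; apply: diag_coef_at_one.
Qed.

Lemma anti_part_at_one (i j : 'I_N) :
  anti_part N I (fun k => y k q) i j @[q --> at_one] --> anti_part N I y0 i j.
Proof.
under eq_fun do rewrite anti_partE.
rewrite anti_partE; apply: cvg_bool => _; apply: cvg_bool; apply: hy.
Qed.

Lemma skew_part_at_one (i j : 'I_N) : ~~ odd N ->
  (forall k, I k -> (1 <= k < N)%N && odd k) ->
  skew_part N I (fun k => y k q) i j @[q --> at_one] --> skew_part N I y0 i j.
Proof.
move=> hN hI; under eq_fun do rewrite skew_partE //.
rewrite skew_partE //; apply: cvg_bool => _; rewrite /skew_coef.
by case: ifP => _; [|apply: cvgN]; apply: cvg_bool; apply: hy.
Qed.

End Entrywise.

(** The relation holds only at generic q, but [at_one] runs through such q, and q^z tends to 1 along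
    it. *)
Lemma product_at_one (I : pred nat) (y : nat -> K -> K) (y0 : nat -> K) i j
    (e : K) (z : int) : scalar_family I y y0 -> I i -> I j ->
  (forall q, generic q -> y i q * y j q = e * q ^ z) -> y0 i * y0 j = e.
Proof.
move=> hy Ii Ij h; rewrite -[RHS]mulr1; apply: at_one_lim h _ _.
  by apply: cvgM; [case: (hy i Ii) | case: (hy j Ij)].
exact: cvg_scaled (exprz_at_one z).
Qed.

Lemma cvg_signed_sum n (e : K) (A B : K -> 'M[K]_n) (A0 B0 : 'M[K]_n) :
  (forall i j, A q i j @[q --> at_one] --> A0 i j) ->
  (forall i j, B q i j @[q --> at_one] --> B0 i j) ->
  (e *: (A q + B q)) @[q --> at_one] --> (e *: (A0 + B0)).
Proof.
move=> hA hB; apply: cvg_entries => i j; rewrite !mxE.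
under eq_fun do rewrite !mxE.
by apply: cvg_scaled; apply: cvgD.
Qed.

End Limits.

Theorem theorem3p5 (R : realType) (r : R[i] -> R[i])
    (hr : square_root_choice r) :
  (* (1) *)
  (forall (g : lie_type) (N m : nat) (b : bool)
      (y : nat -> R[i] -> R[i]) (y0 : nat -> R[i]),
    g = SL \/ g = SO -> admissible g N -> (2 * m <= N)%N ->
    scalar_family (outer N m) y y0 ->
    (forall q i, generic q -> outer N m i ->
       y i q * y (dual N i) q = q ^ (- N%:Z)) ->
    quantizes g r
      (fun q => (-1) ^+ b *:
         (diag_part N m q + anti_part N (outer N m) (fun i => y i q)))
      ((-1) ^+ b *: (diag_part0 R[i] N m + anti_part N (outer N m) y0)) /\
    (forall i, outer N m i -> y0 i * y0 (dual N i) = 1)) /\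
  (* (2) *)
  (forall (N m : nat) (b : bool)
      (z : nat -> R[i] -> R[i]) (z0 : nat -> R[i]),
    let I := fun i => outer N m i && odd i in
    admissible SP N -> ~~ odd m -> (2 * m <= N)%N ->
    scalar_family I z z0 ->
    (forall q i, generic q -> I i ->
       z i q * z (dual N i).-1 q = q ^ (- N%:Z)) ->
    quantizes SP r
      (fun q => (-1) ^+ b *:
         (diag_part N m q + skew_part N I (fun i => z i q)))
      ((-1) ^+ b *: (diag_part0 R[i] N m + skew_part N I z0)) /\
    (forall i, I i -> z0 i * z0 (dual N i).-1 = 1)) /\
  (* (3) *)
  (forall (N : nat) (y : nat -> R[i] -> R[i]) (y0 : nat -> R[i]),
    let I := fun i => (1 <= i <= N)%N in
    admissible SP N ->
    scalar_family I y y0 ->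
    (forall q i, generic q -> I i ->
       y i q * y (dual N i) q = - q ^ (- N%:Z - 2)) ->
    quantizes SP r
      (fun q => anti_part N I (fun i => y i q)) (anti_part N I y0) /\
    (forall i, I i -> y0 i * y0 (dual N i) = -1)) /\
  (* (4) *)
  (forall (N : nat) (z : nat -> R[i] -> R[i]) (z0 : nat -> R[i]),
    let I := fun i => (1 <= i <= N.-1)%N && odd i in
    admissible SO N -> ~~ odd N ->
    scalar_family I z z0 ->
    (forall q i, generic q -> I i -> (2 * i <= N)%N ->
       z i q * z (dual N i).-1 q = - q ^ (- N%:Z + 2)) ->
    quantizes SO r
      (fun q => skew_part N I (fun i => z i q)) (skew_part N I z0) /\
    (forall i, I i -> z0 i * z0 (dual N i).-1 = -1)).

Proof.
have sqr_sign (b : bool) : ((-1) ^+ b) ^+ 2 = 1 :> R[i] by rewrite sqrr_sign.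
split; [|split; [|split]].
- move=> g [|n] m b y y0 hg hN hm hy hyy; first by case: hg hN => ->.
  split; [split|].
  + apply: cvg_signed_sum => i j; first exact: diag_part_at_one.
    by apply: anti_part_at_one => k /hy[].
  + have gSP : g <> SP by case: hg => ->.
    move=> q hq.
    exact: (diag_anti_point hq (hr q hq) gSP hN (sqr_sign b) hm (fun i => hyy q i hq)).
  + move=> i Ii; have Ij : outer n.+1 m (dual n.+1 i) by move: Ii; rewrite /outer; nlia.
    apply: (product_at_one (z := - n.+1%:Z) hy Ii Ij) => q hq.
    by rewrite mul1r hyy.
- move=> [|n] m b z z0 I hN om hm hz hzz; first by [].
  have Neven : ~~ odd n.+1 by case/andP: hN.
  have hI k : I k -> (1 <= k < n.+1)%N && odd k by rewrite /I /outer; nlia.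
  split; [split|].
  + apply: cvg_signed_sum => i j; first exact: diag_part_at_one.
    by apply: skew_part_at_one => // k /hz[].
  + move=> q hq; have [] := diag_skew_point hq (hr q hq) (erefl SP) hN (sqr_sign b)
      om hm (fun i => hzz q i hq).
    by [].
  + move=> i Ii; have Ij : I (dual n.+1 i).-1 by move: Ii; rewrite /I /outer; nlia.
    apply: (product_at_one (z := - n.+1%:Z) hz Ii Ij) => q hq.
    by rewrite mul1r hzz.
- move=> [|n] y y0 I hN hy hyy; first by [].
  split; [split|].
  + by apply: cvg_entries => i j; apply: anti_part_at_one => k /hy[].
  + move=> q hq; have [] := anti_point (y := y ^~ q) hq (hr q hq) (erefl SP) hN; last by [].
    by move=> i hi; apply: hyy => //; rewrite /I; nlia.
  + move=> i Ii; have Ij : I (dual n.+1 i) by move: Ii; rewrite /I; nlia.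
    apply: (product_at_one (z := - n.+1%:Z - 2) hy Ii Ij) => q hq.
    by rewrite mulN1r hyy.
- move=> [|n] z z0 I hN Neven hz hzz; first by [].
  have hI k : I k -> (1 <= k < n.+1)%N && odd k by rewrite /I /=; lia.
  have hJ k : I k -> I (dual n.+1 k).-1 by rewrite /I; nlia.
  (* The relation is given for i at most N/2. The involution sending i to i' - 1 exchanges the two
     factors and carries the remaining odd indices into that range. *)
  have hzz' q i : generic q -> I i ->
      z i q * z (dual n.+1 i).-1 q = - q ^ (- n.+1%:Z + 2).
    move=> hq Ii; have [h|h] := leqP (2 * i) n.+1; first exact: hzz.
    have ei : (dual n.+1 (dual n.+1 i).-1).-1 = i by move: (hI i Ii); nlia.
    by rewrite mulrC -[in z i]ei hzz //; [exact: hJ | nlia].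
  split; [split|].
  + by apply: cvg_entries => i j; apply: skew_part_at_one => // k /hz[].
  + move=> q hq; have [] := skew_point hq (hr q hq) (erefl SO) hN Neven
      (fun i => hzz' q i hq).
    by [].
  + move=> i Ii; apply: (product_at_one (z := - n.+1%:Z + 2) hz Ii (hJ i Ii)) => q hq.
    by rewrite mulN1r hzz'.
Qed.
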